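(* Let $X=(X_{i_1,i_2})_{(i_1,i_2)\in[n]\times[m]}$ be a centered Gaussian random matrix with $\underline\sigma>0$ satisfying condition (A) of the context. Let $a_{m,i}:=\mathbf{E}\bigl(\max_{i_2\in[m]}\frac{X_{i,i_2}}{\sigma_{i,i_2}}\bigr)$ for $i\in[n]$. There exists $C>0$ that depends only on $\underline\sigma$ and $\overline\sigma$ (in particular not on $n,m$) such that for all $\varepsilon>0$ $$\mathcal{L}(\min\max X,\varepsilon)\le C\varepsilon\Bigl(\sum_{i=1}^n a_{m,i}+n\max\bigl(1,\sqrt{\log(\underline\sigma/\varepsilon)}\bigr)\Bigr).$$
   Context: $[r]=\{1,\dots,r\}$. For an $n\times m$ matrix $z$, $\min\max z:=\min_{i_1\in[n]}\max_{i_2\in[m]}z_{i_1,i_2}$. For a random variable $Y$ and $\varepsilon>0$, the anti-concentration function is $\mathcal{L}(Y,\varepsilon):=\sup_{x\in\mathbb{R}}\mathbf{P}(|Y-x|\le\varepsilon)$. Write $\sigma_{i_1,i_2}=\sqrt{\mathrm{Var}(X_{i_1,i_2})}$, $\underline\sigma=\min_{(i_1,i_2)}\sigma_{i_1,i_2}$, $\overline\sigma=\max_{(i_1,i_2)}\sigma_{i_1,i_2}$. Condition (A): $\mathbf{P}\bigl(|\{(i_1,i_2)\in[n]\times[m]:X_{i_1,i_2}=\min\max X\}|>1\bigr)=0$. When $\varepsilon>\underline\sigma$ (so that the logarithm is negative), $\max(1,\sqrt{\log(\underline\sigma/\varepsilon)})$ is read as $1$. *)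

(* Defs.v *)
From HB Require Import structures.
From mathcomp Require Import all_boot all_order all_algebra.
From mathcomp Require Import all_classical all_reals all_analysis.

Set Implicit Arguments.
Unset Strict Implicit.
Unset Printing Implicit Defensive.

Import Order.TTheory GRing.Theory Num.Theory.
Import numFieldNormedType.Exports.

Local Open Scope classical_set_scope.
Local Open Scope ring_scope.

(* Index sets are 'I_n.+1, hence nonempty; starting the iteration from the    *)
(* value at ord0 then gives the true maximum (resp. minimum).                 *)
Definition ord_maxr (R : realType) (n : nat) (f : 'I_n.+1 -> R) : R :=
  \big[Num.max/f ord0]_(i < n.+1) f i.

Definition ord_minr (R : realType) (n : nat) (f : 'I_n.+1 -> R) : R :=
  \big[Num.min/f ord0]_(i < n.+1) f i.

Definition minmax (R : realType) (n m : nat) (z : 'M[R]_(n.+1, m.+1)) : R :=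
  ord_minr (fun i => ord_maxr (fun j => z i j)).

(* The library's normal_prob mu s is not the Dirac mass at mu when s = 0, so  *)
(* the degenerate case is treated separately.                                 *)
Definition gaussian_law (R : realType) (mu s : R) : set R -> \bar R :=
  if s == 0 then dirac mu else normal_prob mu s.

Definition gaussian_rv (d : measure_display) (T : measurableType d)
    (R : realType) (P : probability T R) (Y : T -> R) : Prop :=
  exists mu s : R, 0 <= s /\
    forall B : set R, measurable B -> P (Y @^-1` B) = gaussian_law mu s B.

Section random_matrix.
Context (d : measure_display) (T : measurableType d) (R : realType).
Context (P : probability T R) (n m : nat).
Variable X : 'I_n.+1 -> 'I_m.+1 -> {RV P >-> R}.

Definition sample_mx (w : T) : 'M[R]_(n.+1, m.+1) := \matrix_(i, j) X i j w.

(* Joint Gaussianity; the covariance matrix may be singular.                  *)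
Definition gaussian_mx : Prop :=
  forall c : 'M[R]_(n.+1, m.+1),
    gaussian_rv P (fun w => \sum_i \sum_j c i j * X i j w).

Definition centered_mx : Prop := forall i j, ('E_P[X i j] = 0)%E.

Definition stddev (i : 'I_n.+1) (j : 'I_m.+1) : R :=
  Num.sqrt (fine 'V_P[X i j]%E).

Definition sigma_min : R := ord_minr (fun i => ord_minr (stddev i)).

Definition sigma_max : R := ord_maxr (fun i => ord_maxr (stddev i)).

Definition minmax_unique : Prop :=
  P [set w | (1 < #|[set p : 'I_n.+1 * 'I_m.+1 |
                     sample_mx w p.1 p.2 == minmax (sample_mx w)]%SET|)%N]
  = 0%E.

Definition mean_std_max (i : 'I_n.+1) : \bar R :=
  ('E_P[fun w => ord_maxr (fun j => X i j w / stddev i j)%R])%E.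

End random_matrix.

Definition anticoncentration (d : measure_display) (T : measurableType d)
    (R : realType) (P : probability T R) (Y : T -> R) (eps : R) : \bar R :=
  ereal_sup [set P [set w | `|Y w - x| <= eps] | x in [set: R]].

(* Main.v *)
Require Import Defs.
From HB Require Import structures.
From mathcomp Require Import all_boot all_order all_algebra.
From mathcomp Require Import all_classical all_reals all_analysis.
From mathcomp Require Import measurable_realfun.
From mathcomp Require Import ring lra.

(** The value of [minmax] is the maximum of some row, so if it lies within
    [eps] of [x] then so does one of the row maxima.  By the union bound it is
    enough to prove, for a single centered Gaussian row with standard deviations
    between [slow] and [shigh], that
      P (|max_j X_j - x| <= eps) <= C * eps * (a + 1),
    where [a] is the mean of [max_j X_j / sigma_j]; since
    [1 <= max (1, sqrt (ln (slow / eps)))], summing over the rows concludes.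

    Put [N_j := X_j / sigma_j] and [U_j := N_j - x / sigma_j].  Up to the scale
    [eps / slow], the event says that [max_j U_j] lies in a short interval,
    [v - L <= max_j U_j < v].  Split it according to the first index [j] that
    attains the maximum.  Writing [N_i = rho_ij N_j + V_i] with [V_i] uncorrelated with
    [N_j], the condition that [j] wins against [i] reads
    [V_i <= (1 - rho_ij) N_j + const], and it becomes weaker as [N_j] grows
    because [rho_ij <= 1].  As [N_j] is independent of the [V_i], the
    conditional probability of winning is at most its value at level [v] below
    [v], and at least that value above [v].  Hence the mass of
    the slice (v - L <= U_j < v, j wins) is at most that of (U_j >= v, j wins)
    times the ratio of the corresponding one dimensional Gaussian masses, which
    is at most [exp 3 * L * (1 + B)] if [v - L] is at most [B] standard
    deviations above the mean of [U_j] and [L * (1 + B) <= 1]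
    ([normal_hazard]).  The slices (U_j >= v, j wins) are disjoint, and summing
    over [j] gives [max_interval_le_tail]:
      P (v - L <= max U < v) <= exp 3 * L * (1 + B) * P (v <= max U).
    Here [B] is of order [x], and [max U >= v] forces some [N_j] to be at least
    of order [x]; Markov's inequality for the positive part of [max N], whose
    mean is at most [a + 1], absorbs the factor [1 + B].  If [L * (1 + B) > 1]
    then [x] is of order at least [1 / eps] and Markov's inequality alone is
    enough ([weighted_max_anticoncentration]).

    It remains to see that uncorrelated linear combinations of a jointly
    Gaussian family are independent, starting from the definition of joint
    Gaussianity through linear combinations.  Stein's identity
    E (Y u(Y)) = E Y^2 * E u'(Y) for a centered Gaussian [Y] identifies the
    variance parameter of its law and yields a differential equation for
    t |-> E cos (t Y + a), whence
    E cos (Y + a) = exp (- E Y^2 / 2) * cos a ([gaussian_cos]).  So expectations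
    of trigonometric monomials, hence of trigonometric polynomials, factorize
    over uncorrelated combinations ([factorizing_orthogonals]).  Explicit
    trigonometric polynomials with values in [0, 1] converge pointwise to
    indicators of half-lines, and products of such indicators are all the
    events that the argument above needs ([halfline_factor]). *)

Set Implicit Arguments.
Unset Strict Implicit.
Unset Printing Implicit Defensive.

Import Order.TTheory GRing.Theory Num.Theory.
Import numFieldNormedType.Exports.

Local Open Scope classical_set_scope.
Local Open Scope ring_scope.

(** * Moments of the normal density *)

Lemma norm_le_sqr (R : realType) (x : R) : `|x| <= 2^-1 + 2^-1 * x ^+ 2.
Proof.
by have := sqr_ge0 (`|x| - 1); rewrite -(real_normK (num_real x)); nra.
Qed.

Lemma mul_growth_le (R : realType) (A x v : R) : 0 <= A ->
  `|v| <= A * (1 + `|x|) -> `|x * v| <= 2 * A * (1 + x ^+ 2).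
Proof.
move=> A0 vA; rewrite normrM -(real_normK (num_real x)).
have : 0 <= `|x| by []. move: `|x| `|v| vA => y w wA y0.
apply: (@le_trans _ _ (y * (A * (1 + y)))); first by rewrite ler_wpM2l.
have : 0 <= A * (1 - y) ^+ 2 by rewrite mulr_ge0// sqr_ge0.
have : 0 <= A * y ^+ 2 by rewrite mulr_ge0// sqr_ge0.
by nra.
Qed.

Section normal_density.
Context (R : realType) (m s : R).
Hypothesis s0 : s != 0.
Local Notation mu := (@lebesgue_measure R).
Local Notation N := (normal_prob m s).

Lemma ge0_integral_normal_prob (f : R -> \bar R) :
  (forall x, 0 <= f x)%E -> measurable_fun setT f ->
  (\int[N]_x f x = \int[mu]_x (f x * (normal_pdf m s x)%:E))%E.
Proof.
move=> f0 mf; have dom := normal_prob_dominates m s.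
rewrite -(Radon_Nikodym_SigmaFinite.change_of_variables dom)//.
have fi := Radon_Nikodym_SigmaFinite.f_integrable dom.
apply: ae_eq_integral => //.
- by apply: emeasurable_funM => //; exact: (measurable_int mu).
- apply: emeasurable_funM => //; apply/measurable_EFinP.
  exact: measurable_normal_pdf.
- apply: ae_eqe_mul2l => /=; apply: integral_ae_eq => //.
  + by apply/measurable_EFinP; exact: measurable_normal_pdf.
  + by move=> E _ mE; rewrite -Radon_Nikodym_SigmaFinite.f_integral.
Qed.

Lemma integrable_normal_prob (f : R -> R) : measurable_fun setT f ->
  mu.-integrable setT (fun x => (f x * normal_pdf m s x)%:E) ->
  N.-integrable setT (EFin \o f).
Proof.
move=> mf /integrableP[_ fi]; apply/integrableP; split.
  exact/measurable_EFinP.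
rewrite ge0_integral_normal_prob//; last first.
  by apply: measurableT_comp => //; exact/measurable_EFinP.
apply: le_lt_trans fi; apply: ge0_le_integral => //=.
- by move=> x _; rewrite -EFinM lee_fin mulr_ge0 ?normal_pdf_ge0.
- apply/measurable_EFinP; apply: measurable_funM; first exact: measurableT_comp.
  exact: measurable_normal_pdf.
- apply/measurable_EFinP/measurableT_comp => //; apply: measurable_funM => //.
  exact: measurable_normal_pdf.
- move=> x _; rewrite lee_fin normrM (@ger0_norm _ (normal_pdf _ _ _))//.
  exact: normal_pdf_ge0.
Qed.

Lemma Rintegral_normal_prob (f : R -> R) : measurable_fun setT f ->
  mu.-integrable setT (fun x => (f x * normal_pdf m s x)%:E) ->
  \int[N]_x f x = \int[mu]_x (f x * normal_pdf m s x).
Proof.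
move=> mf fi; congr fine.
have mEf : measurable_fun setT (EFin \o f) by exact/measurable_EFinP.
rewrite integralE [in RHS]integralE.
rewrite !ge0_integral_normal_prob//; last 2 first.
- exact: measurable_funeneg.
- exact: measurable_funepos.
congr (_ - _)%E; apply: eq_integral => x _.
  by rewrite !funeposE EFinM maxe_pMl ?lee_fin ?normal_pdf_ge0// mul0e.
by rewrite !funenegE EFinM maxe_pMl ?lee_fin ?normal_pdf_ge0// mul0e mulNe.
Qed.

Lemma is_derive_normal_pdf (x : R) :
  is_derive x (1 : R) (normal_pdf m s) (- ((x - m) / s ^+ 2) * normal_pdf m s x).
Proof.
rewrite normal_pdfE//.
have d1 : is_derive x (1 : R) (fun x => - (x - m) ^+ 2 / (s ^+ 2 *+ 2)) (- ((x - m) / s ^+ 2)).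
  apply: is_derive_eq => /=.
  rewrite scaler0 add0r subr0.
  change ((s ^+ 2 *+ 2)^-1 * - ((x - m) * 1 + (x - m) * 1) = - ((x - m) / s ^+ 2)).
  by field.
apply: is_derive_eq.
rewrite -/(normal_fun m s x) /GRing.scale /=; ring.
Qed.

(** A normal density of larger variance absorbs a quadratic factor; hence
    all functions of quadratic growth are integrable. *)
Lemma normal_pdf_quadratic_le : exists K, forall x,
  (1 + (x - m) ^+ 2) * normal_pdf m s x <= K * normal_pdf m (s * Num.sqrt 2) x.
Proof.
have s20 : 0 < s ^+ 2 by rewrite exprn_even_gt0.
have r0 : s * Num.sqrt 2 != 0 by rewrite mulf_neq0// gt_eqF// sqrtr_gt0.
exists ((1 + 4 * s ^+ 2) * normal_peak s / normal_peak (s * Num.sqrt 2)) => x.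
rewrite !normal_pdfE// -!mulrA mulKf ?gt_eqF ?normal_peak_gt0//.
rewrite mulrCA [leRHS]mulrCA ler_wpM2l ?normal_peak_ge0//.
rewrite /normal_fun exprMn sqr_sqrtr//.
(* half of the exponent is kept, the other half beats the quadratic factor *)
set z := (x - m) ^+ 2 / (4 * s ^+ 2).
have z0 : 0 <= z by rewrite divr_ge0 ?sqr_ge0// mulr_ge0// ltW.
have -> : - (x - m) ^+ 2 / (s ^+ 2 * 2 *+ 2) = - z.
  by rewrite /z; field.
have -> : - (x - m) ^+ 2 / (s ^+ 2 *+ 2) = - z + - z.
  by rewrite /z; field.
rewrite expRD mulrA ler_wpM2r ?expR_ge0//.
have -> : (x - m) ^+ 2 = 4 * s ^+ 2 * z by rewrite /z; field.
rewrite expRN -ler_pdivlMr ?invr_gt0 ?expR_gt0// invrK.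
have h := expR_ge1Dx z.
apply: (@le_trans _ _ ((1 + 4 * s ^+ 2) * (1 + z))); first by nra.
by rewrite ler_wpM2l// addr_ge0// mulr_ge0// ltW.
Qed.

Lemma integrable_normal_pdf_growth A (f : R -> R) : measurable_fun setT f ->
  (forall x, `|f x| <= A * (1 + (x - m) ^+ 2)) ->
  mu.-integrable setT (fun x => (f x * normal_pdf m s x)%:E).
Proof.
move=> mf fA; have [K KP] := normal_pdf_quadratic_le.
have A0 : 0 <= A.
  by have := le_trans (normr_ge0 _) (fA m); rewrite subrr expr0n addr0 mulr1.
have := integrableZl measurableT (A * K) (integrable_normal_pdf m (s * Num.sqrt 2)).
apply: le_integrable => //.
  by apply/measurable_EFinP/measurable_funM => //; exact: measurable_normal_pdf.
move=> x _ /=; rewrite lee_fin [leRHS]ger0_norm.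
  rewrite normrM (ger0_norm (normal_pdf_ge0 _ _ _)).
  apply: (@le_trans _ _ (A * (1 + (x - m) ^+ 2) * normal_pdf m s x)).
    by rewrite ler_wpM2r ?normal_pdf_ge0.
  by rewrite -!mulrA ler_wpM2l.
rewrite -mulrA mulr_ge0//; apply: le_trans (KP x).
by rewrite mulr_ge0 ?normal_pdf_ge0 ?addr_ge0 ?sqr_ge0.
Qed.
End normal_density.

(** * Stein's identity for the normal law *)

Section normal_stein.
Context (R : realType) (m s : R).
Hypothesis s0 : s != 0.
Local Notation mu := (@lebesgue_measure R).
Local Notation N := (normal_prob m s).

Lemma cvg_Rintegral_itv (h : R -> R) : mu.-integrable setT (EFin \o h) ->
  \int[mu]_(x in `[m - n.+1%:R, m + n.+1%:R]) h x @[n --> \oo] --> \int[mu]_x h x.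
Proof.
move=> hi; apply: fine_cvg; rewrite fineK; last exact: integrable_fin_num.
under eq_fun do rewrite integral_mkcond.
have mh := measurable_int _ hi.
apply: (@dominated_cvg _ _ _ mu setT measurableT
  (fun n => (EFin \o h) \_ `[m - n.+1%:R, m + n.+1%:R]%classic) (EFin \o h)
  (fun x => `|h x|%:E)) => //.
- move=> n; apply/(measurable_restrictT _ _).1 => //.
  exact: measurable_funTS.
- move=> x _.
  have [k kx] : exists k : nat, `|x - m| <= k%:R.
    by exists (Num.trunc `|x - m|).+1; rewrite ltW// truncnS_gt.
  apply: (cvg_near_cst) => //.
  exists k => // n /= kn; rewrite patchE mem_set//= in_itv/=.
  have : `|x - m| <= n.+1%:R by rewrite (le_trans kx)// ler_nat ltnW.
  by rewrite ler_norml; lra.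
- exact: (integrable_abse hi).
- move=> n x _; rewrite patchE; case: ifPn => //= _.
  by rewrite normr0 lee_fin.
Qed.

(** The function [(u' x - (x - m) / s ^+ 2 * u x) * pdf x] is the derivative
    of [u * pdf], which vanishes at infinity, so its integral is zero. *)
Lemma normal_stein (u u' : R -> R) (A : R) :
  (forall x : R, is_derive x (1 : R) u (u' x)) -> continuous u' ->
  (forall x, `|u x| <= A * (1 + `|x - m|)) -> (forall x, `|u' x| <= A) ->
  \int[N]_x ((x - m) * u x) = s ^+ 2 * \int[N]_x u' x.
Proof.
move=> du cu' uA u'A.
have A0 : 0 <= A by apply: le_trans (u'A 0).
have cu : continuous u.
  by move=> x; apply/differentiable_continuous/derivable1_diffP; have [] := du x.
have mu_ : measurable_fun setT u by exact: continuous_measurable_fun.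
have mu'_ : measurable_fun setT u' by exact: continuous_measurable_fun.
pose p := normal_pdf m s.
pose h x := u' x * p x - (s ^+ 2)^-1 * ((x - m) * u x * p x).
have mx : measurable_fun setT (fun x : R => (x - m) * u x).
  by apply: measurable_funM => //; exact: measurable_funB.
have i1 : mu.-integrable setT (fun x => (u' x * p x)%:E).
  apply: (integrable_normal_pdf_growth s0 (A := A)) => // x.
  by apply: le_trans (u'A x) _; rewrite ler_peMr// lerDl sqr_ge0.
have i2 : mu.-integrable setT (fun x => ((x - m) * u x * p x)%:E).
  apply: (integrable_normal_pdf_growth s0 (A := 2 * A)) => // x.
  exact: mul_growth_le.
have ih : mu.-integrable setT (EFin \o h).
  have -> : EFin \o h = (fun x => (u' x * p x)%:E - ((s ^+ 2)^-1)%:E * ((x - m) * u x * p x)%:E)%E.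
    by [].
  by apply: integrableB => //; exact: integrableZl.
rewrite !Rintegral_normal_prob//.
suff : \int[mu]_x h x = 0.
  rewrite /h RintegralB//; last exact: (integrableZl _ ((s^+2)^-1) i2).
  rewrite RintegralZl// => /eqP; rewrite subr_eq0 => /eqP ->.
  by rewrite mulVKf// sqrf_eq0.
pose F x := u x * p x.
have dF (x : R) : is_derive x (1 : R) F (h x).
  have := is_derive_normal_pdf m s0 x; rewrite -/p => dp.
  by apply: is_derive_eq; rewrite /h /GRing.scale /=; field.
have cp : continuous p by exact: continuous_normal_pdf.
have ch : continuous h.
  move=> x; apply: cvgB; apply: cvgM; [exact: cu'|exact: cp|exact: cvg_cst|].
  by apply: cvgM; [apply: cvgM; [apply: cvgB; [exact: cvg_id|exact: cvg_cst]|exact: cu]|exact: cp].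
have FTC n : \int[mu]_(x in `[m - n.+1%:R, m + n.+1%:R]) h x = F (m + n.+1%:R) - F (m - n.+1%:R).
  rewrite /Rintegral (@continuous_FTC2 _ h F)//.
  - have : 0 < n.+1%:R :> R by [].
    lra.
  - exact: continuous_subspaceT.
  - split.
    + by move=> x _; have [] := dF x.
    + apply/cvg_at_right_filter/differentiable_continuous/derivable1_diffP.
      by have [] := dF (m - n.+1%:R).
    + apply/cvg_at_left_filter/differentiable_continuous/derivable1_diffP.
      by have [] := dF (m + n.+1%:R).
  - by move=> x _; rewrite derive1E; have [_ ->] := dF x.
(* the boundary terms at distance [n.+1] from [m] are of order [1 / n.+1] *)
have Fb n x : `|x - m| = n.+1%:R -> `|F x| <= (4 * s ^+ 2 * A * normal_peak s) * n.+1%:R^-1.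
  move=> xn; rewrite normrM (ger0_norm (normal_pdf_ge0 _ _ _)).
  have n1 : 1 <= n.+1%:R :> R by rewrite ler1n.
  rewrite normal_pdfE// /normal_fun.
  rewrite -(real_normK (num_real (x - m))) xn mulNr expRN.
  set y := n.+1%:R ^+ 2 / (s ^+ 2 *+ 2).
  have s20 : 0 < s ^+ 2 by rewrite exprn_even_gt0.
  have y0 : 0 < y by rewrite divr_gt0 ?exprn_gt0 ?ltr0n// mulrn_wgt0.
  have ey : (expR y)^-1 <= y^-1.
    rewrite lef_pV2 ?posrE ?expR_gt0//.
    by have := expR_ge1Dx y; lra.
  apply: (@le_trans _ _ (A * (n.+1%:R *+ 2) * (normal_peak s * y^-1))).
    apply: ler_pM; rewrite ?mulr_ge0 ?normal_peak_ge0 ?invr_ge0 ?expR_ge0//.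
      apply: le_trans (uA x) _; rewrite xn ler_wpM2l// mulr2n; lra.
    by rewrite ler_wpM2l// normal_peak_ge0.
  rewrite le_eqVlt; apply/orP; left; apply/eqP; rewrite /y; field.
  by rewrite s0 /= gt_eqF.
have := cvg_Rintegral_itv ih; under eq_fun do rewrite FTC.
move=> /cvg_unique; apply => //.
pose c := (4 * s ^+ 2 * A * normal_peak s).
have hc : (c * n.+1%:R^-1) @[n --> \oo] --> (0 : R).
  by rewrite -[0](mulr0 c); apply: cvgMr; exact: cvg_harmonic.
rewrite -[0]subr0; apply: cvgB.
  apply: norm_cvg0; apply: (squeeze_cvgr _ (cvg_cst 0) hc).
  apply: nearW => n; rewrite normr_ge0 Fb// addrAC subrr add0r normr_nat//.
apply: norm_cvg0; apply: (squeeze_cvgr _ (cvg_cst 0) hc).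
apply: nearW => n; rewrite normr_ge0 Fb// addrAC subrr add0r normrN normr_nat//.
Qed.
End normal_stein.

(** * Gaussian random variables *)

Section transfer.
Context d d' (T : measurableType d) (T' : measurableType d') (R : realType).
Context (P : probability T R) (nu : {measure set T' -> \bar R}) (Y : T -> T').
Hypothesis mY : measurable_fun setT Y.
Hypothesis lawY : forall B, measurable B -> P (Y @^-1` B) = nu B.

(** Integrals against the law of [Y] only depend on its values on measurable
    sets, which allows replacing it by an explicit measure [nu]. *)
Lemma integral_law (f : T' -> \bar R) :
  (\int[distribution P (mfun_Sub (mem_set mY))]_y f y = \int[nu]_y f y)%E.
Proof. by apply: eq_measure_integral => A mA _; rewrite -lawY. Qed.

Lemma integrable_law (f : T' -> R) : measurable_fun setT f ->
  nu.-integrable setT (EFin \o f) -> P.-integrable setT (EFin \o (f \o Y)).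
Proof.
move=> mf /integrableP[_ fi]; apply/integrableP; split.
  by apply/measurable_EFinP; exact: measurableT_comp.
have mEf : measurable_fun setT (fun y => `|f y|%:E).
  exact/measurable_EFinP/measurableT_comp.
have := @ge0_integral_distribution _ _ _ _ _ P (mfun_Sub (mem_set mY)) _ mEf.
by move=> <-; [rewrite integral_law|move=> y; rewrite lee_fin].
Qed.

Lemma Rintegral_law (f : T' -> R) : measurable_fun setT f ->
  nu.-integrable setT (EFin \o f) ->
  \int[P]_w f (Y w) = \int[nu]_y f y.
Proof.
move=> mf fi; congr fine; rewrite -integral_law.
have mEf : measurable_fun setT (EFin \o f) by exact/measurable_EFinP.
by rewrite (@integral_distribution _ _ _ _ _ P (mfun_Sub (mem_set mY)))//;
  exact: integrable_law.
Qed.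
End transfer.

Section gaussian.
Context d (T : measurableType d) (R : realType) (P : probability T R).

Lemma bounded_probability_integrable (f : T -> R) (A : R) : measurable_fun setT f ->
  (forall w, `|f w| <= A) -> P.-integrable setT (EFin \o f).
Proof.
move=> mf fA; apply: measurable_bounded_integrable => //.
  exact: (le_lt_trans (probability_le1 P measurableT) (ltry _)).
by exists A; split=> [|x Ax w _]; [exact: num_real|exact: le_trans (fA w) (ltW Ax)].
Qed.

Lemma Rintegral_prob_cst (c : R) : \int[P]_w c = c.
Proof. by rewrite Rintegral_cst//= probability_setT mulr1. Qed.

(** Transfer of [normal_stein] along the law of [Y]; the Dirac mass satisfies
    the same identity with [s = 0], both sides being zero. *)
Lemma gaussian_law_stein (Y : T -> R) (m s : R) : measurable_fun setT Y ->
  (forall B : set R, measurable B -> P (Y @^-1` B) = gaussian_law m s B) ->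
    P.-integrable setT (EFin \o (fun w => (Y w - m) ^+ 2)) /\
    forall (u u' : R -> R) (A : R),
    (forall x : R, is_derive x (1 : R) u (u' x)) -> continuous u' ->
    (forall x, `|u x| <= A * (1 + `|x - m|)) -> (forall x, `|u' x| <= A) ->
    P.-integrable setT (EFin \o (fun w => (Y w - m) * u (Y w))) /\
    \int[P]_w ((Y w - m) * u (Y w)) = s ^+ 2 * \int[P]_w u' (Y w).
Proof.
move=> mY lawY.
pose g x := (x - m) ^+ 2 : R.
have mg : measurable_fun setT g by apply: measurable_funX; exact: measurable_funB.
have h (u u' : R -> R) : (forall x : R, is_derive x (1 : R) u (u' x)) ->
    continuous u' -> [/\ measurable_fun setT (fun x : R => (x - m) * u x) &
    measurable_fun setT u'].
  move=> du cu'.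
  have cu : continuous u.
    by move=> x; apply/differentiable_continuous/derivable1_diffP; have [] := du x.
  split; last exact: continuous_measurable_fun.
  apply: measurable_funM; last exact: continuous_measurable_fun.
  exact: measurable_funB.
have [s0|s0] := eqVneq s 0.
  have law0 B : measurable B -> P (Y @^-1` B) = dirac m B.
    by move=> mB; rewrite lawY// /gaussian_law s0 eqxx.
  have di (f : R -> R) : measurable_fun setT f -> (dirac m).-integrable setT (EFin \o f).
    move=> mf; apply/integrableP; split; first exact/measurable_EFinP.
    rewrite integral_dirac//; last first.
      exact/measurable_EFinP/measurableT_comp.
    by rewrite diracT mul1e ltry.
  split; first exact: (integrable_law mY law0 mg (di _ mg)).
  move=> u u' A du cu' uA u'A; have [m1 m2] := h u u' du cu'; split.
    exact: (integrable_law mY law0 m1 (di _ m1)).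
  rewrite (Rintegral_law mY law0 m1 (di _ m1)) s0 expr0n mul0r /Rintegral.
  rewrite integral_dirac//=; first by rewrite subrr mul0r mulr0.
  exact/measurable_EFinP.
have mY' : measurable_fun setT (Y : T -> measurableTypeR R) by [].
have law1 (B : set (measurableTypeR R)) : measurable B -> P (Y @^-1` B) = normal_prob m s B.
  by move=> mB; rewrite lawY// /gaussian_law (negbTE s0).
have gi (f : R -> R) A : measurable_fun setT f -> (forall x, `|f x| <= A * (1 + (x - m) ^+ 2)) ->
   (normal_prob m s).-integrable setT (EFin \o f).
  by move=> mf fA; apply: integrable_normal_prob => //; exact: (integrable_normal_pdf_growth s0 mf fA).
have ig : (normal_prob m s).-integrable setT (EFin \o g).
  by apply: (gi _ 1) => // x; rewrite mul1r ger0_norm ?sqr_ge0// lerDr.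
split; first exact: (integrable_law mY' law1 mg ig).
move=> u u' A du cu' uA u'A; have [m1 m2] := h u u' du cu'.
have A0 : 0 <= A by apply: le_trans (u'A 0).
have i1 : (normal_prob m s).-integrable setT (EFin \o (fun x => (x - m) * u x)).
  apply: (gi _ (2 * A)) => // x.
  exact: mul_growth_le.
have i2 : (normal_prob m s).-integrable setT (EFin \o u').
  by apply: (gi _ A) => // x; apply: le_trans (u'A x) _; rewrite ler_peMr// lerDl sqr_ge0.
split; first exact: (integrable_law mY' law1 m1 i1).
rewrite (Rintegral_law mY' law1 m1 i1) (Rintegral_law mY' law1 m2 i2)//.
exact: (normal_stein s0 du cu' uA u'A).
Qed.

(** Taking [u] constant identifies the mean of the law and taking [u] the
    identity identifies its variance, so the parameters of the law of a
    centered Gaussian variable can be read off from its second moment. *)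
Lemma gaussian_stein (Y : T -> R) : measurable_fun setT Y -> gaussian_rv P Y ->
  \int[P]_w Y w = 0 ->
  [/\ P.-integrable setT (EFin \o (fun w => (Y w) ^+ 2)),
  forall B : set R, measurable B ->
    P (Y @^-1` B) = gaussian_law 0 (Num.sqrt (\int[P]_w (Y w) ^+ 2)) B &
  forall (u u' : R -> R) (A : R),
    (forall x : R, is_derive x (1 : R) u (u' x)) -> continuous u' ->
    (forall x, `|u x| <= A) -> (forall x, `|u' x| <= A) ->
    \int[P]_w (Y w * u (Y w)) = (\int[P]_w (Y w) ^+ 2) * \int[P]_w u' (Y w)].
Proof.
move=> mY gY EY; case: gY => m [s [s0 lawY]].
have [i2 st] := gaussian_law_stein mY lawY.
have [] := st (cst 1) (cst 0) 1.
- by move=> x; exact: cvg_cst.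
- by move=> x; rewrite mul1r normr1 lerDl.
- by move=> x; rewrite normr0.
rewrite /= Rintegral_prob_cst mulr0; have -> : (fun w => (Y w - m) * 1) = (fun w => Y w - m).
  by apply/funext => w; rewrite mulr1.
move=> i1.
have iY : P.-integrable setT (EFin \o Y).
  have -> : EFin \o Y = (EFin \o (fun w => Y w - m)) \+ (EFin \o cst m).
    by apply/funext => w /=; rewrite -EFinD subrK.
  apply: integrableD => //.
  by apply: (bounded_probability_integrable (A := `|m|)).
rewrite RintegralB//; last first.
  by apply: (bounded_probability_integrable (A := `|m|)).
rewrite EY Rintegral_prob_cst sub0r => /eqP; rewrite oppr_eq0 => /eqP m0.
move: st i2 lawY; rewrite m0 => st.
have -> : (fun w => (Y w - 0) ^+ 2) = (fun w => Y w ^+ 2).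
  by apply/funext => w; rewrite subr0.
move=> i2 lawY.
have [] := st id (cst 1) 1.
- by move=> x; exact: cvg_cst.
- by move=> x; rewrite mul1r subr0 lerDr.
- by move=> x; rewrite normr1.
rewrite Rintegral_prob_cst mulr1 => _.
under eq_Rintegral do rewrite subr0 -expr2.
move=> ->; split => //; first by rewrite sqrtr_sqr ger0_norm.
move=> u u' A du cu' uA u'A.
have [|_ <-] := st u u' A du cu' _ u'A.
- move=> x; apply: le_trans (uA x) _; rewrite ler_peMr// ?lerDl//.
  exact: le_trans (uA x).
by apply: eq_Rintegral => w _; rewrite subr0.
Qed.
End gaussian.

(** * Characteristic function of a Gaussian random variable *)

Section gaussian_cos.
Context d (T : measurableType d) (R : realType) (P : probability T R).

(** With [V := E Y^2], [gaussian_stein] shows that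
    [G t := E cos (t * Y + a)] solves [G' t = - V * t * G t]. *)
Lemma gaussian_cos (Y : T -> R) (a : R) : measurable_fun setT Y -> gaussian_rv P Y ->
  \int[P]_w Y w = 0 ->
  \int[P]_w cos (Y w + a) = expR (- (\int[P]_w (Y w) ^+ 2) / 2) * cos a.
Proof.
move=> mY gY EY; have [i2 _ st] := gaussian_stein mY gY EY.
set V := \int[P]_w (Y w) ^+ 2.
pose f (t : R) (w : T) : R := cos (t * Y w + a).
have mcos : measurable_fun setT (@cos R) by exact: continuous_measurable_fun (@continuous_cos R).
have mtY t : measurable_fun setT (fun w => t * Y w + a).
  by apply: measurable_funD => //; exact: measurable_funM.
have intf t : P.-integrable setT (EFin \o f t).
  apply: (bounded_probability_integrable _ (A := 1)).
    exact: measurableT_comp.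
  by move=> w; exact: cos_max.
have dlin (t y : R) : is_derive t (1 : R) (fun t : R => t * y + a) y.
  by apply: is_derive_eq; rewrite scaler0 /GRing.scale /= addr0 mulr1 add0r.
have df (t : R) w : is_derive t (1 : R) (f ^~ w) (- (Y w * sin (t * Y w + a))).
  rewrite /f; have := dlin t (Y w) => h.
  by apply: is_derive_eq; rewrite /GRing.scale /=; ring.
have d1f t w : partial1of2 f t w = - (Y w * sin (t * Y w + a)).
  by rewrite /partial1of2 derive1E; have [_ ->] := df t w.
have iG : P.-integrable setT (EFin \o (fun w => 1 + Y w ^+ 2)).
  have -> : EFin \o (fun w => 1 + Y w ^+ 2) = (EFin \o cst 1) \+ (EFin \o (fun w => Y w ^+ 2)) by [].
  apply: integrableD => //.
  by apply: (bounded_probability_integrable _ (A := 1)) => // w /=; rewrite normr1.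
have G0 w : 0 <= 1 + Y w ^+ 2 by rewrite addr_ge0// sqr_ge0.
have dub t w : `|partial1of2 f t w| <= 1 + Y w ^+ 2.
  rewrite d1f normrN normrM.
  apply: (@le_trans _ _ `|Y w|); first by rewrite ler_piMr// sin_max.
  by have := norm_le_sqr (Y w); have := sqr_ge0 (Y w); lra.
pose G t := \int[P]_w f t w.
have dS t x : is_derive x (1 : R) (fun x => sin (t * x + a)) (t * cos (t * x + a)).
  have h : is_derive x (1 : R) (fun x : R => t * x + a) t.
      by apply: is_derive_eq; rewrite /GRing.scale /= addr0 mulr1.
  by apply: is_derive_eq; rewrite /GRing.scale /= mulrC.
have stc t : \int[P]_w (Y w * sin (t * Y w + a)) = V * (t * G t).
  rewrite (st _ _ (1 + `|t|) (dS t)).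
  - rewrite -/V; congr (_ * _); rewrite RintegralZl//; exact: intf.
  - move=> x; apply: cvgM; first exact: cvg_cst.
    apply: (cvg_comp (fun x => t * x + a) cos); last exact: continuous_cos.
    by apply: cvgD; [apply: cvgM; [exact: cvg_cst|exact: cvg_id]|exact: cvg_cst].
  - by move=> x; apply: (le_trans (sin_max _)); rewrite lerDl.
  - move=> x; rewrite normrM; apply: (@le_trans _ _ `|t|); last by rewrite lerDr.
    by rewrite ler_piMr// cos_max.
have dG (t : R) : is_derive t (1 : R) G (- (V * (t * G t))).
  have tI : `]t - 1, t + 1[%classic t by rewrite /= in_itv/=; lra.
  have dfI (x : R) w : `]t - 1, t + 1[%classic x -> setT w -> derivable (f ^~ w) x 1.
    by move=> _ _; have [] := df x w.
  have fI x : `]t - 1, t + 1[%classic x -> P.-integrable setT (EFin \o f x) by [].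
  have uI x w : `]t - 1, t + 1[%classic x -> setT w -> `|partial1of2 f x w| <= 1 + Y w ^+ 2 by [].
  have := derivable_under_integral measurableT tI fI dfI G0 iG uI.
  have := differentiation_under_integral measurableT tI fI dfI G0 iG uI.
  rewrite -/G derive1E => DG dG; apply: DeriveDef => //; rewrite DG.
  under eq_Rintegral do rewrite d1f -mulN1r.
  rewrite RintegralZl ?stc ?mulN1r//.
  have iY : P.-integrable setT (EFin \o (fun w => Y w * sin (t * Y w + a))).
    apply: le_integrable iG => //.
      apply/measurable_EFinP/measurable_funM => //.
      by apply: measurableT_comp => //; exact: continuous_measurable_fun (@continuous_sin R).
    move=> w _ /=; rewrite lee_fin (ger0_norm (G0 w)).
    by have := dub t w; rewrite d1f normrN.
  exact: iY.
(* the differential equation makes [H] constant *)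
pose H t := G t * expR (V / 2 * t ^+ 2).
have dH (t : R) : is_derive t (1 : R) H 0.
  have := dG t => dGt.
  rewrite /H; apply: is_derive_eq; rewrite /GRing.scale /=.
  by field.
have := @is_derive_0_is_cst _ H 1 0 dH.
rewrite /H /G /f expr1n expr0n/= mulr1 mulr0 expR0 mulr1.
under eq_Rintegral do rewrite mul1r.
under [X in _ = X]eq_Rintegral do rewrite mul0r add0r.
rewrite Rintegral_prob_cst => <-.
by rewrite mulrCA mulNr -expRD addNr expR0 mulr1.
Qed.
End gaussian_cos.

(** * Trigonometric approximation of half-lines *)

Section step.
Context (R : realType).
Implicit Types (x t a z : R) (n m : nat) (b : bool).

Lemma bernoulli_ineq a n : -1 <= a -> 1 + n%:R * a <= (1 + a) ^+ n.
Proof.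
move=> a1; elim: n => [|n IH]; first by rewrite mul0r addr0 expr0.
rewrite exprS; apply: (@le_trans _ _ ((1 + a) * (1 + n%:R * a))).
  have : 0 <= n%:R * a ^+ 2 by rewrite mulr_ge0// sqr_ge0.
  by rewrite -[n.+1%:R]natr1; nra.
by rewrite ler_wpM2l//; lra.
Qed.

Lemma expr_1B_le a n : 0 <= a <= 1 -> (1 - a) ^+ n <= (1 + n%:R * a)^-1.
Proof.
move=> /andP[a0 a1]; have na : 0 < 1 + n%:R * a by rewrite ltr_pwDl// mulr_ge0.
rewrite -[leRHS]mul1r ler_pdivlMr//.
apply: (@le_trans _ _ ((1 - a) ^+ n * (1 + a) ^+ n)).
  by rewrite ler_wpM2l ?exprn_ge0 ?bernoulli_ineq//; lra.
by rewrite -exprMn exprn_ile1//; nra.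
Qed.

(** A polynomial in [z] that approximates the indicator of [0 < z] on [-1, 1]:
    with [y := (1 + z) / 2], [(1 - y ^+ m) ^+ (2 ^ m)] is close to 1 when
    [2 * y] is less than 1 and close to 0 when [2 * y] exceeds 1, by
    Bernoulli's inequality. *)
Definition sharpen m z : R := 1 - (1 - ((1 + z) / 2) ^+ m) ^+ (2 ^ m).

Lemma sharpen_itv m z : -1 <= z <= 1 -> 0 <= sharpen m z <= 1.
Proof.
move=> z1; have y0 : 0 <= ((1 + z) / 2) ^+ m by rewrite exprn_ge0//; lra.
have y1 : ((1 + z) / 2) ^+ m <= 1 by rewrite exprn_ile1//; lra.
have e0 : 0 <= (1 - ((1 + z) / 2) ^+ m) ^+ (2 ^ m) by rewrite exprn_ge0//; lra.
have e1 : (1 - ((1 + z) / 2) ^+ m) ^+ (2 ^ m) <= 1 by rewrite exprn_ile1//; lra.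
by rewrite /sharpen; lra.
Qed.

Lemma sharpen_ge m z : 0 <= z <= 1 -> 1 - (1 + m%:R * z)^-1 <= sharpen m z.
Proof.
move=> z1; rewrite lerD2l lerN2.
have y0 : 0 <= ((1 + z) / 2) ^+ m by rewrite exprn_ge0//; lra.
have y1 : ((1 + z) / 2) ^+ m <= 1 by rewrite exprn_ile1//; lra.
apply: (le_trans (expr_1B_le _ _)); first by rewrite y0 y1.
have mz : 0 <= m%:R * z by rewrite mulr_ge0//; lra.
have h : (2 ^ m)%:R * ((1 + z) / 2) ^+ m = (1 + z) ^+ m.
  by rewrite natrX -exprMn mulrC divfK.
have b : 1 + m%:R * z <= (1 + z) ^+ m by apply: bernoulli_ineq; lra.
by rewrite h lef_pV2 ?posrE; lra.
Qed.

Lemma sharpen_opp_le m z : 0 <= z <= 1 -> sharpen m (- z) <= (1 + m%:R * z)^-1.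
Proof.
move=> z1; apply: le_trans (expr_1B_le m z1).
have y0 : 0 <= ((1 - z) / 2) ^+ m by rewrite exprn_ge0//; lra.
have y1 : ((1 - z) / 2) ^+ m <= 1 by rewrite exprn_ile1//; lra.
have := @bernoulli_ineq (- ((1 - z) / 2) ^+ m) (2 ^ m).
have -> : (2 ^ m)%:R * - ((1 - z) / 2) ^+ m = - (1 - z) ^+ m.
  by rewrite mulrN natrX -exprMn [2 * _]mulrC divfK.
move=> /(_ ltac:(lra)).
by rewrite /sharpen; lra.
Qed.

Lemma sin_ge_cos1 x : 0 <= x <= 1 -> x * cos 1 <= sin x.
Proof.
move=> /andP[]; rewrite le_eqVlt => /predU1P[<- _|x0 x1]; first by rewrite mul0r sin0.
have [c cx] : exists2 c, c \in `]0, x[ & sin x - sin 0 = cos c * (x - 0).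
  apply: MVT => //; apply: continuous_subspaceT; exact: continuous_sin.
rewrite sin0 !subr0 => ->; rewrite mulrC ler_wpM2r//; first exact: ltW.
move: cx; rewrite in_itv/= => /andP[c0 cx].
have := pi_ge2 R => pi2.
have [-> //|c1] := eqVneq c 1.
by apply: ltW; rewrite ltr_cos ?in_itv/=; lra.
Qed.

(** The period grows with [n], so that in the limit the sine only remembers the
    sign of [t]; the exponent [n.+1 ^ 3] grows fast enough to compensate
    for the smallness of the sine near 0. *)
Definition trig_step n t : R := sharpen (n.+1 ^ 3) (sin (t / n.+1%:R)).

Lemma trig_step_itv n t : 0 <= trig_step n t <= 1.
Proof. by apply: sharpen_itv; rewrite sin_geN1 sin_le1. Qed.

Let trig_step_err n : R := (cos 1)^-1 * n.+1%:R^-1.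

Let err_le n t : n.+1%:R^-1 <= t <= n.+1%:R -> 
  [/\ 0 <= sin (t / n.+1%:R) <= 1 & 
  (1 + (n.+1 ^ 3)%:R * sin (t / n.+1%:R))^-1 <= trig_step_err n].
Proof.
move=> /andP[t0 t1]; have n0 : 0 < n.+1%:R :> R by rewrite ltr0n.
have c1 : 0 < cos 1 :> R := cos1_gt0 R.
have nV0 : 0 < n.+1%:R^-1 :> R by rewrite invr_gt0.
have u1 : 0 <= t / n.+1%:R <= 1.
  rewrite ler_pdivrMr// mul1r t1 andbT divr_ge0//.
  exact: le_trans (ltW nV0) t0.
have s1 := sin_ge_cos1 u1.
have s0 : 0 <= sin (t / n.+1%:R).
  by apply: le_trans s1; apply: mulr_ge0; [case/andP: u1|exact: ltW].
split; first by rewrite s0 sin_le1.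
rewrite /trig_step_err -invfM lef_pV2 ?posrE ?mulr_gt0//; last first.
  by rewrite ltr_pwDl// mulr_ge0.
apply: (@le_trans _ _ ((n.+1 ^ 3)%:R * (t / n.+1%:R * cos 1))); last first.
  by apply: (@le_trans _ _ ((n.+1 ^ 3)%:R * sin (t / n.+1%:R))); [rewrite ler_wpM2l|rewrite lerDr].
rewrite natrX.
have -> : n.+1%:R ^+ 3 * (t / n.+1%:R * cos 1) = (cos 1 * n.+1%:R) * (n.+1%:R * t).
  by field; rewrite gt_eqF.
rewrite ler_peMr//; first by apply: mulr_ge0 => //; exact: ltW.
by rewrite -[leLHS](@mulfV _ (n.+1%:R : R)) ?gt_eqF// ler_wpM2l.
Qed.

Lemma trig_step_near1 n t : n.+1%:R^-1 <= t <= n.+1%:R ->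
  `|trig_step n t - 1| <= (cos 1)^-1 * n.+1%:R^-1.
Proof.
move=> /err_le[s0 e]; have := sharpen_ge (n.+1 ^ 3) s0.
have := trig_step_itv n t; rewrite /trig_step => h1 h2.
rewrite ler0_norm; last by lra.
by rewrite opprB lerBlDl -lerBlDr; apply: le_trans h2; rewrite lerD2l lerN2.
Qed.

Lemma trig_step_near0 n t : n.+1%:R^-1 <= - t <= n.+1%:R ->
  `|trig_step n t| <= (cos 1)^-1 * n.+1%:R^-1.
Proof.
move=> /err_le[s0 e]; have := sharpen_opp_le (n.+1 ^ 3) s0.
have := trig_step_itv n t; rewrite /trig_step; rewrite mulNr sinN opprK => h1 h2.
rewrite ger0_norm; last by lra.
apply: le_trans h2 _; move: e; rewrite mulNr sinN; exact.
Qed.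

(** The flag tells whether the endpoint belongs to the half-line; both kinds
    occur since ties between Gaussian coordinates may have positive
    probability. *)
Definition halfline b x := if b then 0 <= x else 0 < x.

(** The vanishing shift pushes the endpoint 0 to the correct side. *)
Definition halfline_step b n x : R := trig_step n (x - (-1) ^+ b / n.+1%:R).

Lemma cvg_halfline_step b x :
  halfline_step b n x @[n --> \oo] --> ((halfline b x)%:R : R).
Proof.
have hc : ((cos 1)^-1 * n.+1%:R^-1) @[n --> \oo] --> (0 : R).
  by rewrite -[0](mulr0 (cos 1)^-1); apply: cvgMr; exact: cvg_harmonic.
apply: cvg_zero; apply: norm_cvg0; apply: (squeeze_cvgr _ (cvg_cst 0) hc).
have Vx n : 0 < (n.+1%:R^-1 : R) <= 1.
  by rewrite invr_gt0 ltr0n/= invf_le1 ?ltr0n// ler1n.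
near=> n; rewrite normr_ge0/=.
have nx : `|x| + 1 <= n.+1%:R.
  near: n; exists (Num.trunc (`|x| + 1)).+1 => // n /= kn.
  by apply: ltW; apply: (lt_le_trans (truncnS_gt _)); rewrite ler_nat ltnW.
have nx2 : x != 0 -> 2 / n.+1%:R <= `|x|.
  move=> x0; have nx0 : 0 < `|x| by rewrite normr_gt0.
  rewrite ler_pdivrMr ?ltr0n// mulrC -ler_pdivrMr//.
  near: n; exists (Num.trunc (2 / `|x|)).+1 => // n /= kn.
  by apply: ltW; apply: (lt_le_trans (truncnS_gt _)); rewrite ler_nat ltnW.
have := Vx n; rewrite /halfline_step; move: nx nx2; set k : R := n.+1%:R => nx nx2 Vn.
rewrite /halfline !fctE -/k; case: b => /=.
  rewrite expr1 mulN1r opprK; have [x0|x0] := leP 0 x.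
    apply: trig_step_near1; rewrite -/k; clearbody k.
    by rewrite ger0_norm// in nx; apply/andP; split; lra.
  rewrite subr0; apply: trig_step_near0; rewrite -/k; clearbody k.
  by rewrite ltr0_norm// lt_eqF// in nx nx2; have := nx2 isT => h; apply/andP; split; lra.
rewrite expr0 mul1r; have [x0|x0] := ltP 0 x.
  apply: trig_step_near1; rewrite -/k; clearbody k.
  by rewrite gtr0_norm// gt_eqF// in nx nx2; have := nx2 isT => h; apply/andP; split; lra.
rewrite subr0; apply: trig_step_near0; rewrite -/k; clearbody k.
by rewrite ler0_norm// in nx; apply/andP; split; lra.
Unshelve. all: by end_near. Qed.
End step.

(** * From trigonometric polynomials to half-lines *)

Section trig_span.
Context (T : Type) (R : realType) (L : (T -> R) -> Prop).

(** Real trigonometric polynomials in the members of [L]. *)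
Inductive trig_span : (T -> R) -> Prop :=
| trig_span_cos S a of L S : trig_span (fun w => cos (S w + a))
| trig_span_lin c f g of trig_span f & trig_span g :
    trig_span (fun w => c * f w + g w).

Hypothesis L0 : L (fun=> 0).
Hypothesis Llin : forall c S S', L S -> L S' -> L (fun w => c * S w + S' w).

Lemma trig_span_cst c : trig_span (fun=> c).
Proof.
have t1 := trig_span_cos 0 L0.
have -> : (fun=> c) = (fun w : T => (c - 1) * cos (0 + 0) + cos (0 + 0)).
  by apply/funext => w; rewrite addr0 cos0; ring.
exact: (trig_span_lin _ t1 t1).
Qed.

(** Product-to-sum formula. *)
Lemma trig_spanM f g : trig_span f -> trig_span g ->
  trig_span (fun w => f w * g w).
Proof.
move=> ft gt; elim: ft => {f} [S a LS|c f1 f2 _ IH1 _ IH2]; last first.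
  have -> : (fun w => (c * f1 w + f2 w) * g w) =
            (fun w => c * (f1 w * g w) + f2 w * g w).
    by apply/funext => w; ring.
  exact: trig_span_lin.
elim: gt => {g} [S' a' LS'|c g1 g2 _ IH1 _ IH2]; last first.
  have -> : (fun w => cos (S w + a) * (c * g1 w + g2 w)) =
            (fun w => c * (cos (S w + a) * g1 w) + cos (S w + a) * g2 w).
    by apply/funext => w; ring.
  exact: trig_span_lin.
have -> : (fun w => cos (S w + a) * cos (S' w + a')) =
  (fun w => 2^-1 * cos ((1 * S w + S' w) + (a + a')) +
     (2^-1 * cos ((- 1 * S' w + S w) + (a - a')) + 0)).
  apply/funext => w.
  have -> : 1 * S w + S' w + (a + a') = (S w + a) + (S' w + a') by ring.
  have -> : - 1 * S' w + S w + (a - a') = (S w + a) - (S' w + a') by ring.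
  by move: (S w + a) (S' w + a') => A B; rewrite cosD cosB; field.
apply: trig_span_lin; first by apply: trig_span_cos; exact: Llin.
apply: trig_span_lin; last exact: trig_span_cst.
by apply: trig_span_cos; exact: Llin.
Qed.

Lemma trig_spanX f n : trig_span f -> trig_span (fun w => f w ^+ n).
Proof.
move=> ft; elim: n => [|n IH]; first exact: trig_span_cst.
by under eq_fun do rewrite exprS; exact: trig_spanM.
Qed.

Lemma trig_span_prod (I : Type) (r : seq I) (f : I -> T -> R) :
  (forall i, trig_span (f i)) -> trig_span (fun w => \prod_(i <- r) f i w).
Proof.
move=> ft; elim: r => [|i r IH].
  by under eq_fun do rewrite big_nil; exact: trig_span_cst.
by under eq_fun do rewrite big_cons; exact: trig_spanM.
Qed.

Lemma trig_span_1B f : trig_span f -> trig_span (fun w => 1 - f w).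
Proof.
move=> ft; have := trig_span_lin (- 1) ft (trig_span_cst 1).
by under eq_fun do rewrite mulN1r addrC.
Qed.

Lemma trig_span_halfline_step b n S c : L S ->
  trig_span (fun w => halfline_step b n (S w + c)).
Proof.
move=> LS; apply: trig_span_1B; apply: trig_spanX; apply: trig_span_1B.
apply: trig_spanX.
(* a sine is a shifted cosine *)
set k := n.+1%:R; set e := (-1) ^+ b / k.
have -> : (fun w => (1 + sin ((S w + c - e) / k)) / 2) =
  (fun w => 2^-1 * cos ((k^-1 * S w + 0) + ((c - e) / k - pi / 2)) + 2^-1).
  apply/funext => w.
  have -> : k^-1 * S w + 0 + ((c - e) / k - pi / 2) =
            (S w + c - e) / k - pi / 2 by ring.
  by rewrite cosBpihalf; ring.
apply: trig_span_lin; last exact: trig_span_cst.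
by apply: trig_span_cos; exact: Llin.
Qed.

End trig_span.

Section independence.
Context d (T : measurableType d) (R : realType) (P : probability T R).

Lemma bounded_convergence (f_ : nat -> T -> R) (f : T -> R) (A : R) :
  (forall n, measurable_fun setT (f_ n)) -> (forall n w, `|f_ n w| <= A) ->
  (forall w, f_ n w @[n --> \oo] --> f w) ->
  \int[P]_w f_ n w @[n --> \oo] --> \int[P]_w f w.
Proof.
move=> mf fA ff.
have mEf n : measurable_fun setT (EFin \o f_ n) by exact/measurable_EFinP.
have cf w : setT w -> (EFin \o f_ n) w @[n --> \oo] --> (EFin \o f) w.
  by move=> _; apply: cvg_EFin; [exact: nearW|exact: ff].
have mf_ : measurable_fun setT f.
  by apply/measurable_EFinP; exact: emeasurable_fun_cvg mEf cf.
have fA' w : `|f w| <= A.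
  have h : `|f_ n w| @[n --> \oo] --> `|f w| by apply: cvg_norm; exact: ff.
  move/cvg_lim : (h) => <- //; apply: limr_le; last exact: nearW.
  by apply/cvg_ex; eexists; exact: h.
apply: fine_cvg; rewrite fineK.
  apply: (@dominated_cvg _ _ _ P setT measurableT (fun n => EFin \o f_ n) _ (EFin \o cst A)) => //.
  apply: (bounded_probability_integrable _ (A := `|A|)) => //.
  by move=> n w _; rewrite lee_fin.
apply: integrable_fin_num => //.
exact: (bounded_probability_integrable _ mf_ fA').
Qed.

(** Independence of the two families, tested on characters only. *)
Definition factorizing (L1 L2 : (T -> R) -> Prop) := forall S1 S2 a1 a2,
  L1 S1 -> L2 S2 ->
  \int[P]_w (cos (S1 w + a1) * cos (S2 w + a2)) =
  \int[P]_w cos (S1 w + a1) * \int[P]_w cos (S2 w + a2).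

Lemma trig_span_bounded (L : (T -> R) -> Prop) f :
  (forall S, L S -> measurable_fun setT S) -> trig_span L f ->
  measurable_fun setT f /\ exists A, forall w, `|f w| <= A.
Proof.
move=> mL; elim=> {f} [S a LS|c f g _ [mf [A fA]] _ [mg [B gB]]].
  split; last by exists 1 => w; exact: cos_max.
  apply: measurableT_comp.
    exact: continuous_measurable_fun (@continuous_cos R).
  by apply: measurable_funD => //; exact: mL.
split; first by apply: measurable_funD => //; exact: measurable_funM.
exists (`|c| * A + B) => w; apply: (le_trans (ler_normD _ _)).
by rewrite lerD// normrM ler_wpM2l.
Qed.

Variables L1 L2 : (T -> R) -> Prop.
Hypothesis mL1 : forall S, L1 S -> measurable_fun setT S.
Hypothesis mL2 : forall S, L2 S -> measurable_fun setT S.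
Hypothesis L12 : factorizing L1 L2.

Let int1 f g : trig_span L1 f -> trig_span L2 g ->
  [/\ P.-integrable setT (EFin \o f), P.-integrable setT (EFin \o g) &
    P.-integrable setT (EFin \o (fun w => f w * g w))].
Proof.
move=> /(trig_span_bounded mL1)[mf [A fA]] /(trig_span_bounded mL2)[mg [B gB]].
split.
- exact: (bounded_probability_integrable _ mf fA).
- exact: (bounded_probability_integrable _ mg gB).
- apply: (bounded_probability_integrable _ (A := A * B)).
    exact: measurable_funM.
  by move=> w; rewrite normrM ler_pM.
Qed.

Let RintegralL c (f g : T -> R) : P.-integrable setT (EFin \o f) ->
  P.-integrable setT (EFin \o g) ->
  \int[P]_w (c * f w + g w) = c * \int[P]_w f w + \int[P]_w g w.
Proof.
move=> fi gi; rewrite RintegralD//; first by rewrite RintegralZl.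
exact: (integrableZl measurableT c fi).
Qed.

Lemma trig_span_factor f g : trig_span L1 f -> trig_span L2 g ->
  \int[P]_w (f w * g w) = \int[P]_w f w * \int[P]_w g w.
Proof.
move=> ft gt; elim: ft => {f} [S a LS|c f1 f2 t1 IH1 t2 IH2]; last first.
  have [i1 ig i1g] := int1 t1 gt; have [i2 _ i2g] := int1 t2 gt.
  transitivity (\int[P]_w (c * (f1 w * g w) + f2 w * g w)).
    by apply: eq_Rintegral => w _; ring.
  by rewrite !RintegralL// IH1 IH2; ring.
elim: gt => {g} [S' a' LS'|c g1 g2 t1 IH1 t2 IH2]; first exact: L12.
have [_ i1 i1g] := int1 (trig_span_cos a LS) t1.
have [_ i2 i2g] := int1 (trig_span_cos a LS) t2.
transitivity (\int[P]_w (c * (cos (S w + a) * g1 w) + cos (S w + a) * g2 w)).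
  by apply: eq_Rintegral => w _; ring.
by rewrite !RintegralL// IH1 IH2; ring.
Qed.

Hypothesis L10 : L1 (fun=> 0).
Hypothesis L1lin : forall c S S', L1 S -> L1 S' -> L1 (fun w => c * S w + S' w).
Hypothesis L20 : L2 (fun=> 0).
Hypothesis L2lin : forall c S S', L2 S -> L2 S' -> L2 (fun w => c * S w + S' w).

(** Both indicators are pointwise limits of trigonometric polynomials bounded
    by 1, for which [trig_span_factor] applies. *)
Lemma halfline_factor (I : finType) (b : bool) S c
    (bs : I -> bool) (V : I -> T -> R) (cs : I -> R) :
  L1 S -> (forall i, L2 (V i)) ->
  \int[P]_w ((halfline b (S w + c))%:R *
     \prod_i (halfline (bs i) (V i w + cs i))%:R) =
  \int[P]_w (halfline b (S w + c))%:R *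
  \int[P]_w \prod_i (halfline (bs i) (V i w + cs i))%:R.
Proof.
move=> LS LV.
pose f n w : R := halfline_step b n (S w + c).
pose g n w : R := \prod_i halfline_step (bs i) n (V i w + cs i).
have ft n : trig_span L1 (f n) by exact: trig_span_halfline_step.
have gt n : trig_span L2 (g n).
  by apply: trig_span_prod => // i; exact: trig_span_halfline_step.
have mf n := (trig_span_bounded mL1 (ft n)).1.
have mg n := (trig_span_bounded mL2 (gt n)).1.
have f1 n w : `|f n w| <= 1.
  by have /andP[? ?] := trig_step_itv n (S w + c - (-1) ^+ b / n.+1%:R); rewrite ger0_norm.
have g1 n w : `|g n w| <= 1.
  rewrite normr_prod; apply: prodr_ile1 => i _; rewrite normr_ge0/=.
  by have /andP[? ?] := trig_step_itv n (V i w + cs i - (-1) ^+ bs i / n.+1%:R); rewrite ger0_norm.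
have cf w : f n w @[n --> \oo] --> ((halfline b (S w + c))%:R : R).
  exact: cvg_halfline_step.
have cg w : g n w @[n --> \oo] --> (\prod_i (halfline (bs i) (V i w + cs i))%:R : R).
  rewrite /g; elim: (index_enum I) => [|i r IH].
    by rewrite big_nil; under eq_fun do rewrite big_nil; exact: cvg_cst.
  rewrite big_cons; under eq_fun do rewrite big_cons.
  by apply: cvgM => //; exact: cvg_halfline_step.
have h1 := bounded_convergence mf f1 cf.
have h2 := bounded_convergence mg g1 cg.
have h3 : \int[P]_w (f n w * g n w) @[n --> \oo] -->
    \int[P]_w ((halfline b (S w + c))%:R *
     \prod_i (halfline (bs i) (V i w + cs i))%:R).
  apply: (@bounded_convergence _ _ 1).
  - by move=> n; exact: measurable_funM.
  - by move=> n w; rewrite normrM mulr_ile1.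
  - by move=> w; apply: cvgM.
have h4 := cvgM h1 h2.
move: h3; under eq_fun do rewrite trig_span_factor//.
by move=> /cvg_unique; apply => //; exact: h4.
Qed.

End independence.

(** * Uncorrelated combinations of a Gaussian family *)

Section standard_gaussian_family.
Context d (T : measurableType d) (R : realType) (P : probability T R).
Context (k : nat) (N : 'I_k -> T -> R).
Hypothesis mN : forall i, measurable_fun setT (N i).
Hypothesis gN : forall c : 'I_k -> R, gaussian_rv P (fun w => \sum_i c i * N i w).
Hypothesis EN : forall i, \int[P]_w N i w = 0.
Hypothesis VN : forall i, \int[P]_w (N i w) ^+ 2 = 1.

Definition linear_span (S : T -> R) : Prop :=
  exists c : 'I_k -> R, S = (fun w => \sum_i c i * N i w).

Lemma linear_span_mem i : linear_span (N i).
Proof.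
exists (fun l => (l == i)%:R); apply/funext => w.
rewrite (bigD1 i)//= eqxx mul1r big1 ?addr0// => l li.
by rewrite (negbTE li) mul0r.
Qed.

Lemma linear_span_lin c S S' : linear_span S -> linear_span S' ->
  linear_span (fun w => c * S w + S' w).
Proof.
move=> [a ->] [b ->]; exists (fun i => c * a i + b i); apply/funext => w.
by rewrite mulr_sumr -big_split/=; apply: eq_bigr => i _; ring.
Qed.

Lemma linear_span0 : linear_span (fun=> 0).
Proof.
by exists (fun=> 0); apply/funext => w; rewrite big1// => i _; rewrite mul0r.
Qed.

Lemma linear_span_measurable S : linear_span S -> measurable_fun setT S.
Proof.
by move=> [c ->]; apply: measurable_sum => i; exact: measurable_funM.
Qed.

Let gaussian_mem i : gaussian_rv P (N i).
Proof. by have [c ->] := linear_span_mem i; exact: gN. Qed.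

Let integrable_of_sqr (f : T -> R) : measurable_fun setT f ->
  P.-integrable setT (EFin \o (fun w => f w ^+ 2)) ->
  P.-integrable setT (EFin \o f).
Proof.
move=> mf i2.
have i3 : P.-integrable setT (EFin \o (fun w => 1 + f w ^+ 2)).
  have -> : EFin \o (fun w => 1 + f w ^+ 2) =
    (EFin \o cst 1) \+ (EFin \o (fun w => f w ^+ 2)) by [].
  apply: integrableD => //.
  by apply: (bounded_probability_integrable _ (A := 1)) => // w /=; rewrite normr1.
apply: le_integrable i3 => //; first exact/measurable_EFinP.
move=> w _ /=; rewrite lee_fin (@ger0_norm _ (1 + _)) ?addr_ge0 ?sqr_ge0//.
by have := norm_le_sqr (f w); have := sqr_ge0 (f w); lra.
Qed.

(** Integrability comes from [gaussian_stein], hence from the Gaussian law. *)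
Lemma linear_span_centered S : linear_span S ->
  P.-integrable setT (EFin \o S) /\ \int[P]_w S w = 0.
Proof.
move=> [c ->]; elim: (index_enum _) => [|i r [IHi IH0]].
  under eq_fun do rewrite big_nil.
  split; last exact: Rintegral_prob_cst.
  by apply: (bounded_probability_integrable _ (A := 0)) => // w; rewrite normr0.
under eq_fun do rewrite big_cons.
have [i2 _ _] := gaussian_stein (@mN i) (gaussian_mem i) (EN i).
have i1 := integrable_of_sqr (@mN i) i2.
have ci := integrableZl measurableT (c i) i1.
split.
  have -> : EFin \o (fun w => c i * N i w + \sum_(l <- r) c l * N l w) =
   (fun w => (c i)%:E * (EFin \o N i) w)%E \+ (EFin \o (fun w => \sum_(l <- r) c l * N l w)) by [].
  exact: integrableD.
rewrite (@RintegralD _ _ _ _ _ (fun w => c i * N i w) _ measurableT ci IHi).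
by rewrite RintegralZl// EN mulr0 add0r.
Qed.

Lemma linear_span_sqr_integrable S : linear_span S ->
  P.-integrable setT (EFin \o (fun w => S w ^+ 2)).
Proof.
move=> LS; have [_ S0] := linear_span_centered LS.
have mS := linear_span_measurable LS.
by case: (LS) => c Sc; have [] := gaussian_stein mS _ S0; rewrite Sc.
Qed.

Lemma linear_span_cos S a : linear_span S ->
  \int[P]_w cos (S w + a) = expR (- (\int[P]_w (S w) ^+ 2) / 2) * cos a.
Proof.
move=> LS; have [_ S0] := linear_span_centered LS.
have mS := linear_span_measurable LS.
by case: (LS) => c Sc; apply: gaussian_cos => //; rewrite Sc.
Qed.

Lemma linear_span_mul_integrable S S' : linear_span S -> linear_span S' ->
  P.-integrable setT (EFin \o (fun w => S w * S' w)).
Proof.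
move=> LS LS'.
have i3 : P.-integrable setT (EFin \o (fun w => S w ^+ 2 + S' w ^+ 2)).
  have -> : EFin \o (fun w => S w ^+ 2 + S' w ^+ 2) =
    (EFin \o (fun w => S w ^+ 2)) \+ (EFin \o (fun w => S' w ^+ 2)) by [].
  by apply: integrableD => //; exact: linear_span_sqr_integrable.
apply: le_integrable i3 => //.
  by apply/measurable_EFinP; apply: measurable_funM; exact: linear_span_measurable.
move=> w _ /=; rewrite lee_fin normrM (@ger0_norm _ (_ + _)) ?addr_ge0 ?sqr_ge0//.
have := sqr_ge0 (`|S w| - `|S' w|).
rewrite -(real_normK (num_real (S w))) -(real_normK (num_real (S' w))).
have : 0 <= `|S w| by []. have : 0 <= `|S' w| by []. nra.
Qed.

Lemma Rintegral_mul_lin c S S' U : linear_span S -> linear_span S' ->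
  linear_span U ->
  \int[P]_w ((c * S w + S' w) * U w) =
  c * \int[P]_w (S w * U w) + \int[P]_w (S' w * U w).
Proof.
move=> LS LS' LU; have i1 := linear_span_mul_integrable LS LU.
have i2 := linear_span_mul_integrable LS' LU.
transitivity (\int[P]_w (c * (S w * U w) + S' w * U w)).
  by apply: eq_Rintegral => w _; ring.
rewrite RintegralD//; first by rewrite RintegralZl.
exact: (integrableZl measurableT c i1).
Qed.

Variable j : 'I_k.

Definition multiples (S : T -> R) : Prop := exists c : R, S = (fun w => c * N j w).

Definition orthogonals (S : T -> R) : Prop :=
  linear_span S /\ \int[P]_w (S w * N j w) = 0.

Lemma multiples0 : multiples (fun=> 0).
Proof. by exists 0; apply/funext => w; rewrite mul0r. Qed.

Lemma multiples_lin c S S' : multiples S -> multiples S' ->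
  multiples (fun w => c * S w + S' w).
Proof.
by move=> [a ->] [b ->]; exists (c * a + b); apply/funext => w; ring.
Qed.

Lemma orthogonals0 : orthogonals (fun=> 0).
Proof.
split; first exact: linear_span0.
by under eq_Rintegral do rewrite mul0r; exact: Rintegral_prob_cst.
Qed.

Lemma orthogonals_lin c S S' : orthogonals S -> orthogonals S' ->
  orthogonals (fun w => c * S w + S' w).
Proof.
move=> [LS S0] [LS' S'0]; split; first exact: linear_span_lin.
by rewrite Rintegral_mul_lin ?S0 ?S'0 ?mulr0 ?addr0//; exact: linear_span_mem.
Qed.

Lemma multiples_span S : multiples S -> linear_span S.
Proof.
move=> [c ->]; have := linear_span_lin c (linear_span_mem j) linear_span0.
by under eq_fun do rewrite addr0.
Qed.

(** The product of two cosines is a half sum of cosines of [S1 + S2] and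
    [S1 - S2]; both combinations have second moment [E S1^2 + E S2^2], so
    that [linear_span_cos] gives a factorized expression. *)
Lemma factorizing_orthogonals : factorizing P multiples orthogonals.
Proof.
move=> S1 S2 a1 a2 MS1 [L2 S20]; have L1 := multiples_span MS1.
have S120 : \int[P]_w (S2 w * S1 w) = 0.
  case: MS1 => c ->.
  transitivity (\int[P]_w (c * (S2 w * N j w))).
    by apply: eq_Rintegral => w _; ring.
  rewrite RintegralZl ?S20 ?mulr0//.
  by apply: linear_span_mul_integrable => //; exact: linear_span_mem.
have V e : e ^+ 2 = 1 -> \int[P]_w (e * S2 w + S1 w) ^+ 2 =
    \int[P]_w S1 w ^+ 2 + \int[P]_w S2 w ^+ 2.
  move=> e1.
  have Le := linear_span_lin e L2 L1.
  transitivity (\int[P]_w ((e * S2 w + S1 w) * (e * S2 w + S1 w))).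
    by apply: eq_Rintegral => w _; rewrite expr2.
  rewrite Rintegral_mul_lin//.
  transitivity (e * \int[P]_w ((e * S2 w + S1 w) * S2 w) + \int[P]_w ((e * S2 w + S1 w) * S1 w)).
    by congr (e * _ + _); apply: eq_Rintegral => w _; rewrite mulrC.
  rewrite !Rintegral_mul_lin// S120.
  have -> : \int[P]_w (S1 w * S2 w) = 0.
    by rewrite -S120; apply: eq_Rintegral => w _; rewrite mulrC.
  have -> : \int[P]_w (S1 w * S1 w) = \int[P]_w S1 w ^+ 2.
    by apply: eq_Rintegral => w _; rewrite expr2.
  have -> : \int[P]_w (S2 w * S2 w) = \int[P]_w S2 w ^+ 2.
    by apply: eq_Rintegral => w _; rewrite expr2.
  have -> : e * (e * \int[P]_w S2 w ^+ 2 + 0) = e ^+ 2 * \int[P]_w S2 w ^+ 2 by ring.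
  by rewrite e1; ring.
have ci e a : P.-integrable setT (EFin \o (fun w => cos ((e * S2 w + S1 w) + a))).
  apply: (bounded_probability_integrable _ (A := 1)); last first.
    by move=> w; exact: cos_max.
  apply: measurableT_comp; first exact: continuous_measurable_fun (@continuous_cos R).
  by apply: measurable_funD => //; apply: linear_span_measurable; exact: linear_span_lin.
transitivity (\int[P]_w (2^-1 * cos ((1 * S2 w + S1 w) + (a1 + a2)) +
   2^-1 * cos ((-1 * S2 w + S1 w) + (a1 - a2)))).
  apply: eq_Rintegral => w _.
  have -> : 1 * S2 w + S1 w + (a1 + a2) = (S1 w + a1) + (S2 w + a2) by ring.
  have -> : - 1 * S2 w + S1 w + (a1 - a2) = (S1 w + a1) - (S2 w + a2) by ring.
  by move: (S1 w + a1) (S2 w + a2) => A B; rewrite cosD cosB; field.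
rewrite RintegralD//; last 2 first.
- exact: (integrableZl measurableT _ (ci 1 (a1 + a2))).
- exact: (integrableZl measurableT _ (ci (-1) (a1 - a2))).
rewrite !RintegralZl// !linear_span_cos//; last 2 first.
- exact: linear_span_lin.
- exact: linear_span_lin.
rewrite !V ?expr1n ?sqrrN ?expr1n// cosD cosB.
set v1 := \int[P]_w S1 w ^+ 2; set v2 := \int[P]_w S2 w ^+ 2.
have -> : - (v1 + v2) / 2 = - v1 / 2 + - v2 / 2 by field.
by rewrite expRD; field.
Qed.

(** The part of [N i] that is not explained by its regression on [N j]. *)
Definition residual i w := - (\int[P]_w (N i w * N j w)) * N j w + N i w.

Lemma orthogonals_residual i : orthogonals (residual i).
Proof.
split; first by apply: linear_span_lin; exact: linear_span_mem.
rewrite Rintegral_mul_lin; [|exact: linear_span_mem..].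
have -> : \int[P]_w (N j w * N j w) = 1.
  by rewrite -(VN j); apply: eq_Rintegral => w _; rewrite expr2.
by rewrite mulr1 addNr.
Qed.

Lemma correlation_le1 i : \int[P]_w (N i w * N j w) <= 1.
Proof.
have i2 l := linear_span_sqr_integrable (linear_span_mem l).
have ij := linear_span_mul_integrable (linear_span_mem i) (linear_span_mem j).
have h : \int[P]_w (N i w * N j w) <= \int[P]_w (2^-1 * N i w ^+ 2 + 2^-1 * N j w ^+ 2).
  apply: le_Rintegral => //.
    have e1 := integrableZl measurableT 2^-1 (i2 i).
    have e2 := integrableZl measurableT 2^-1 (i2 j).
    exact: (integrableD measurableT e1 e2).
  by move=> w _; have := sqr_ge0 (N i w - N j w); lra.
apply: (le_trans h); rewrite RintegralD//; last 2 first.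
- exact: (integrableZl measurableT _ (i2 i)).
- exact: (integrableZl measurableT _ (i2 j)).
by rewrite !RintegralZl// !VN; lra.
Qed.

(** This is the only form in which independence of [N j] and its residuals is
    used: one half-line for [N j], one for each residual. *)
Lemma halfline_residual_factor b c (bs : 'I_k -> bool) (cs : 'I_k -> R) :
  \int[P]_w ((halfline b (N j w + c))%:R *
     \prod_i (halfline (bs i) (- residual i w + cs i))%:R) =
  \int[P]_w (halfline b (N j w + c))%:R *
  \int[P]_w \prod_i (halfline (bs i) (- residual i w + cs i))%:R.
Proof.
apply: (halfline_factor (P := P) _ _ factorizing_orthogonals).
- by move=> S /multiples_span; exact: linear_span_measurable.
- by move=> S [/linear_span_measurable].
- exact: multiples0.
- exact: multiples_lin.
- exact: orthogonals0.
- exact: orthogonals_lin.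
- by exists 1; apply/funext => w; rewrite mul1r.
- move=> i; have := orthogonals_lin (-1) (orthogonals_residual i) orthogonals0.
  by under eq_fun do rewrite mulN1r addr0.
Qed.

End standard_gaussian_family.

(** * Short intervals against tails of the normal law *)

Section normal_hazard.
Context (R : realType).
Local Notation mu := (@lebesgue_measure R).

(** The ratio of the densities at [x] and [y] is
    [expR ((y - x) * (y + x) / 2)]. *)
Lemma normal_pdf_shift (x y c : R) : (y - x) * (y + x) <= c *+ 2 ->
  normal_pdf 0 1 x <= expR c * normal_pdf 0 1 y.
Proof.
move=> xy; rewrite !normal_pdfE// mulrCA ler_wpM2l ?normal_peak_ge0//.
rewrite /normal_fun !subr0 expr1n -expRD ler_expR.
have -> : c + - y ^+ 2 / (1 *+ 2) = (c *+ 2 - y ^+ 2) / 2 by field.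
by rewrite ler_wpM2r//; lra.
Qed.

(** With [v := u + L], the density is at most [expR 1 * pdf v] on the interval
    and at least [expR (- 2) * pdf v] on an interval of length [1 / (1 + B)]
    to the right of [v]. *)
Lemma normal_hazard (u L B : R) : 0 < L -> u <= B -> 0 <= B ->
  L * (1 + B) <= 1 ->
  (normal_prob 0 1 `[u, (u + L)%R[ <=
   (expR 3 * L * (1 + B))%:E * normal_prob 0 1 `[(u + L)%R, +oo[)%E.
Proof.
move=> L0 uB B0 LB.
have L1 : L <= 1 by nra.
pose h := (1 + B)^-1; pose v := u + L.
have B1 : 0 < 1 + B by lra.
have h0 : 0 < h by rewrite invr_gt0.
have h1 : h <= 1 by rewrite invf_le1//; lra.
have hB : h * (1 + B) = 1 by rewrite mulVf// gt_eqF.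
have p0 := normal_pdf_ge0 0 1 v.
have up : (normal_prob 0 1 `[u, (u + L)%R[ <= (expR 1 * normal_pdf 0 1 v * L)%:E)%E.
  apply: (@le_trans _ _ (\int[mu]_(x in `[u, (u + L)%R[) (expR 1 * normal_pdf 0 1 v)%:E)%E).
    apply: ge0_le_integral => //=.
    - by move=> x _; rewrite lee_fin normal_pdf_ge0.
    - by apply/measurable_EFinP/measurable_funTS; exact: measurable_normal_pdf.
    - move=> x; rewrite in_itv/= => /andP[ux xv]; rewrite lee_fin.
      by apply: normal_pdf_shift; rewrite /v; nra.
  rewrite integral_cst//= lebesgue_measure_itv/= lte_fin ltrDl L0.
  by rewrite -EFinD -EFinM lee_fin addrAC subrr add0r.
have lo : ((expR (- 2) * normal_pdf 0 1 v * h)%:E <= normal_prob 0 1 `[v, +oo[)%E.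
  apply: (@le_trans _ _ (normal_prob 0 1 `[v, (v + h)%R[)); last first.
    apply: le_measure; rewrite ?inE//; apply: subset_itvl; by rewrite bnd_simp.
  apply: (@le_trans _ _ (\int[mu]_(x in `[v, (v + h)%R[) (expR (- 2) * normal_pdf 0 1 v)%:E)%E).
    rewrite integral_cst//= lebesgue_measure_itv/= lte_fin ltrDl h0.
    by rewrite -EFinD -EFinM lee_fin addrAC subrr add0r.
  apply: ge0_le_integral => //=.
  - by move=> x _; rewrite lee_fin mulr_ge0 ?expR_ge0.
  - by apply/measurable_EFinP/measurable_funTS; exact: measurable_normal_pdf.
  - move=> x; rewrite in_itv/= => /andP[ux xv]; rewrite lee_fin.
    rewrite expRN ler_pdivrMl ?expR_gt0//.
    by apply: normal_pdf_shift; rewrite /v in ux xv *; nra.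
apply: (le_trans up).
have c0 : 0 <= expR 3 * L * (1 + B).
  by rewrite mulr_ge0 ?mulr_ge0 ?expR_ge0//; lra.
apply: (@le_trans _ _ ((expR 3 * L * (1 + B))%:E * (expR (- 2) * normal_pdf 0 1 v * h)%:E)%E); last first.
  by rewrite lee_wpmul2l// lee_fin.
rewrite -EFinM lee_fin le_eqVlt; apply/orP; left; apply/eqP.
have -> : expR 3 = expR 1 * expR 2 :> R by rewrite -expRD; congr expR; lra.
rewrite expRN; transitivity (expR 1 * normal_pdf 0 1 v * L * (h * (1 + B))).
  by rewrite hB mulr1.
by field; rewrite gt_eqF ?expR_gt0.
Qed.
End normal_hazard.

(** * Maximum of a standardized Gaussian family *)

Section ord_maxr.
Context (R : realType) (n : nat).
Implicit Types (f : 'I_n.+1 -> R).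

Lemma ord_maxr_ge f i : f i <= ord_maxr f.
Proof. exact: le_bigmax. Qed.

Lemma ord_maxr_attained f : exists i, ord_maxr f = f i.
Proof.
rewrite /ord_maxr; elim/big_ind: _ => [|x y [i ->] [j ->]|i _]; first by exists ord0.
  by case: (leP (f i) (f j)) => _; [exists j|exists i].
by exists i.
Qed.

Lemma ord_minr_attained f : exists i, ord_minr f = f i.
Proof.
rewrite /ord_minr; elim/big_ind: _ => [|x y [i ->] [j ->]|i _]; first by exists ord0.
  by case: (leP (f i) (f j)) => _; [exists i|exists j].
by exists i.
Qed.

Lemma ord_minr_le f i : ord_minr f <= f i.
Proof. exact: bigmin_le. Qed.
End ord_maxr.

Section first_argmax.
Context (R : realType) (n : nat) (U : 'I_n.+1 -> R).

(** Indicator of the event that [j] is the smallest index at which [U] is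
    maximal, as a product of half-line indicators: [j] must beat smaller
    indices strictly and larger ones weakly. *)
Definition first_argmax (j : 'I_n.+1) : R :=
  \prod_(i < n.+1) (halfline (j <= i)%N (U j - U i))%:R.

Lemma first_argmax_unique i j : first_argmax i != 0 -> first_argmax j != 0 -> i = j.
Proof.
move=> /prodf_neq0 hi /prodf_neq0 hj; apply/val_inj/eqP.
have := hi j isT; have := hj i isT; rewrite /halfline.
case: ltngtP => //= _; rewrite pnatr_eq0 eqb0 negbK pnatr_eq0 eqb0 negbK; lra.
Qed.

Lemma first_argmax_exists : exists2 j, first_argmax j = 1 & U j = ord_maxr U.
Proof.
have [i0 i0P] := ord_maxr_attained U.
have P0 : U i0 == ord_maxr U by rewrite i0P.
case: (@arg_minnP _ i0 (fun i => U i == ord_maxr U) (fun i => i : nat) P0) => j /eqP jP jmin.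
exists j => //; apply: big1 => i _; rewrite /halfline.
have := ord_maxr_ge U i; rewrite -jP => Ui.
case: leqP => [_|ij]; first by rewrite subr_ge0 Ui.
rewrite subr_gt0 lt_neqAle Ui andbT jP.
by case: eqVneq => [/eqP/jmin|//]; rewrite leqNgt ij.
Qed.

Lemma first_argmax01 j : first_argmax j = 0 \/ first_argmax j = 1.
Proof.
rewrite /first_argmax; elim/big_ind: _ => [|x y [->|->] [->|->]|i _]; rewrite ?mulr0 ?mul0r ?mulr1;
  try by [left|right].
by case: halfline; [right|left].
Qed.
End first_argmax.

Section halfline_prob.
Context d (T : measurableType d) (R : realType) (P : probability T R).

Lemma halfline_mono b (x y : R) : x <= y -> (halfline b x)%:R <= (halfline b y)%:R :> R.
Proof.
move=> xy; rewrite ler_nat /halfline; case: b.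
  by case: (leP 0 x) => // x0; rewrite (le_trans x0 xy).
by case: (ltP 0 x) => // x0; rewrite (lt_le_trans x0 xy).
Qed.

Lemma measurable_halfline b (f : T -> R) : measurable_fun setT f ->
  measurable [set w | halfline b (f w)].
Proof.
move=> mf; rewrite -[X in measurable X]setTI; case: b => /=.
  have -> : [set w | 0 <= f w] = f @^-1` `[0, +oo[%classic.
    by apply/seteqP; split => w /=; rewrite in_itv/= andbT.
  by apply: mf.
have -> : [set w | 0 < f w] = f @^-1` `]0, +oo[%classic.
  by apply/seteqP; split => w /=; rewrite in_itv/= andbT.
by apply: mf.
Qed.

Lemma measurable_boolr (b : T -> bool) : measurable [set w | b w] ->
  measurable_fun setT (fun w => (b w)%:R : R).
Proof.
move=> mb; have -> : (fun w => (b w)%:R : R) = \1_[set w | b w].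
  apply/funext => w; rewrite indicE; case: (boolP (b w)) => h.
    by rewrite mem_set.
  by rewrite memNset//; apply/negP.
exact: measurable_indic.
Qed.

Lemma Rintegral_boolr (b : T -> bool) : measurable [set w | b w] ->
  (\int[P]_w (b w)%:R)%:E = P [set w | b w].
Proof.
move=> mb; have -> : \int[P]_w (b w)%:R = \int[P]_w \1_[set w | b w] w.
  apply: eq_Rintegral => w _; rewrite indicE; case: (boolP (b w)) => h.
    by rewrite mem_set.
  by rewrite memNset//; apply/negP.
rewrite /Rintegral integral_indic// setIT fineK//.
exact: fin_num_measure.
Qed.
End halfline_prob.

Section max_anticoncentration.
Context d (T : measurableType d) (R : realType) (P : probability T R).
Context (k : nat) (N : 'I_k.+1 -> T -> R) (b : 'I_k.+1 -> R).
Hypothesis mN : forall i, measurable_fun setT (N i).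
Hypothesis gN : forall c : 'I_k.+1 -> R, gaussian_rv P (fun w => \sum_i c i * N i w).
Hypothesis EN : forall i, \int[P]_w N i w = 0.
Hypothesis VN : forall i, \int[P]_w (N i w) ^+ 2 = 1.
Variables (L B v : R).
Hypothesis L0 : 0 < L.
Hypothesis B0 : 0 <= B.
Hypothesis LB : L * (1 + B) <= 1.
Hypothesis bB : forall i, v - L - b i <= B.

Let U i w := N i w + b i.
Let win i w := first_argmax (fun i => U i w) i.
Let ge v i w : R := (halfline true (N i w + (b i - v)))%:R.

Let geE v' i w : ge v' i w = (v' <= U i w)%R%:R.
Proof. by rewrite /ge /halfline /U addrA subr_ge0. Qed.

Let int01 (f : T -> R) : measurable_fun setT f -> (forall w, 0 <= f w <= 1) ->
  P.-integrable setT (EFin \o f).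
Proof.
move=> mf f01; apply: (bounded_probability_integrable _ (A := 1)) => // w.
by have /andP[? ?] := f01 w; rewrite ger0_norm.
Qed.

Let mge v' i : measurable_fun setT (ge v' i).
Proof. by apply: measurable_boolr; apply: measurable_halfline; exact: measurable_funD. Qed.

Let prod01 (f : 'I_k.+1 -> bool) : 0 <= (\prod_i (f i)%:R : R) <= 1.
Proof.
apply/andP; split; first by apply: prodr_ge0.
by apply: prodr_ile1 => i _; rewrite ler0n lern1 leq_b1.
Qed.

Let mwin j : measurable_fun setT (win j).
Proof.
apply: measurable_prod => i _; apply: measurable_boolr; apply: measurable_halfline.
by apply: measurable_funB; exact: measurable_funD.
Qed.

Let tail_ratio j : \int[P]_w (ge (v - L) j w - ge v j w) <=
  expR 3 * L * (1 + B) * \int[P]_w ge v j w.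
Proof.
have gm : gaussian_rv P (N j) by have [c ->] := linear_span_mem N j; exact: gN.
have [_ lawN _] := gaussian_stein (@mN j) gm (EN j).
have {}lawN (C : set R) : measurable C -> P (N j @^-1` C) = normal_prob 0 1 C.
  by move=> mC; rewrite lawN// VN sqrtr1 /gaussian_law oner_eq0.
pose u := v - L - b j.
have uL : u + L = v - b j by rewrite /u; ring.
have := normal_hazard L0 (bB j) B0 LB; rewrite -/u uL -!lawN//.
have -> : N j @^-1` `[u, (v - b j)[%classic = [set w | (v - L <= U j w) && (U j w < v)].
  apply/seteqP; split => w /=; rewrite in_itv/= /u /U => /andP[? ?]; apply/andP; split; lra.
have -> : N j @^-1` `[(v - b j), +oo[%classic = [set w | v <= U j w].
  apply/seteqP; split => w /=; rewrite in_itv/= /U andbT; lra.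
have mU : measurable_fun setT (U j) by exact: measurable_funD.
have m2 : measurable [set w | v <= U j w].
  have := @measurable_halfline _ T R true (fun w => N j w + (b j - v)).
  rewrite /halfline; under eq_set do rewrite addrA subr_ge0.
  by apply; exact: measurable_funD.
have m1 : measurable [set w | (v - L <= U j w) && (U j w < v)].
  have -> : [set w | (v - L <= U j w) && (U j w < v)] = U j @^-1` `[(v - L), v[%classic.
    by apply/seteqP; split => w /=; rewrite in_itv.
  by rewrite -[X in measurable X]setTI; apply: mU.
rewrite -!Rintegral_boolr// -EFinM lee_fin => h.
under eq_Rintegral do rewrite !geE.
under [X in _ <= _ * X]eq_Rintegral do rewrite geE.
apply: le_trans h; rewrite le_eqVlt; apply/orP; left; apply/eqP.
apply: eq_Rintegral => w _; move: (U j w) => x.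
have [x1|x1] := leP (v - L) x; have [x2|x2] := leP v x => //=; rewrite ?subrr ?subr0//.
by exfalso; move: L0 x1 x2; lra.
Qed.

Let M w := ord_maxr (fun i => N i w + b i).

Let measurable_ge_max v' : measurable [set w | v' <= M w].
Proof.
have -> : [set w | v' <= M w] = \bigcup_(i in [set: 'I_k.+1]) [set w | v' <= U i w].
  apply/seteqP; split => w /=.
    by rewrite /M; have [i ->] := ord_maxr_attained (fun i => N i w + b i); exists i.
  by move=> [i _] /= /le_trans; apply; exact: (ord_maxr_ge (fun i => N i w + b i)).
apply: fin_bigcup_measurable => // i _.
have := @measurable_halfline _ T R true (fun w => N i w + (b i - v')).
rewrite /halfline; under eq_set do rewrite addrA subr_ge0.
by apply; exact: measurable_funD.
Qed.

Let argmax_ratio j :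
  \int[P]_w ((ge (v - L) j w - ge v j w) * win j w) <=
  expR 3 * L * (1 + B) * \int[P]_w (ge v j w * win j w).
Proof.
pose rho i := \int[P]_w (N i w * N j w).
have rho1 i : 0 <= 1 - rho i by rewrite subr_ge0; exact: correlation_le1.
(* [D] is the winning event of [j] with [N j] frozen at [v - b j], that is
   [U j] frozen at [v]: it contains the true one below [v] and is contained
   in it above. *)
pose D w : R := \prod_(i < k.+1) (halfline (j <= i)%N
  (- residual P N j i w + ((1 - rho i) * (v - b j) + (b j - b i))))%:R.
have mD : measurable_fun setT D.
  apply: measurable_prod => i _; apply: measurable_boolr; apply: measurable_halfline.
  apply: measurable_funD => //; apply: measurableT_comp => //.
  by apply: measurable_funD => //; exact: measurable_funM.
have UE i w : U j w - U i w =
    - residual P N j i w + ((1 - rho i) * N j w + (b j - b i)).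
  by rewrite /residual /U -/(rho i); ring.
have winD_lo w : U j w < v -> win j w <= D w.
  move=> Uv; apply: ler_prod => i _; rewrite ler0n/=; apply: halfline_mono.
  rewrite UE lerD2l lerD2r ler_wpM2l//; move: Uv; rewrite /U; lra.
have winD_hi w : v <= U j w -> D w <= win j w.
  move=> Uv; apply: ler_prod => i _; rewrite ler0n/=; apply: halfline_mono.
  rewrite UE lerD2l lerD2r ler_wpM2l//; move: Uv; rewrite /U; lra.
have indep v' : \int[P]_w (ge v' j w * D w) = \int[P]_w ge v' j w * \int[P]_w D w.
  exact: halfline_residual_factor.
have ge01 v' w : 0 <= ge v' j w <= 1 by rewrite ler0n lern1 leq_b1.
have ige v' : P.-integrable setT (EFin \o ge v' j) by apply: int01.
have igeM v' (f : T -> R) : measurable_fun setT f -> (forall w, 0 <= f w <= 1) ->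
    P.-integrable setT (EFin \o (fun w => ge v' j w * f w)).
  move=> mf f01; apply: int01; first exact: measurable_funM.
  move=> w; have /andP[? ?] := ge01 v' w; have /andP[? ?] := f01 w.
  by rewrite mulr_ge0//= mulr_ile1.
have D01 w : 0 <= D w <= 1 by exact: prod01.
have W01 w : 0 <= win j w <= 1 by exact: prod01.
have igB (f : T -> R) : measurable_fun setT f -> (forall w, 0 <= f w <= 1) ->
    P.-integrable setT (EFin \o (fun w => (ge (v - L) j w - ge v j w) * f w)).
  move=> mf f01.
  have -> : (fun w => (ge (v - L) j w - ge v j w) * f w) =
            (fun w => ge (v - L) j w * f w - ge v j w * f w).
    by apply/funext => w; rewrite mulrBl.
  exact: (integrableB measurableT (igeM _ _ mf f01) (igeM _ _ mf f01)).
apply: (@le_trans _ _ (\int[P]_w ((ge (v - L) j w - ge v j w) * D w))).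
  apply: le_Rintegral => //; [exact: igB|exact: igB|].
  move=> w _; rewrite !geE; have [Uv|Uv] := leP v (U j w).
    have -> : v - L <= U j w by move: L0; lra.
    by rewrite subrr !mul0r.
  by rewrite subr0 ler_wpM2l ?ler0n// winD_lo.
have -> : \int[P]_w ((ge (v - L) j w - ge v j w) * D w) =
    \int[P]_w (ge (v - L) j w - ge v j w) * \int[P]_w D w.
  transitivity (\int[P]_w (ge (v - L) j w * D w - ge v j w * D w)).
    by apply: eq_Rintegral => w _; rewrite mulrBl.
  rewrite (RintegralB measurableT (igeM (v - L) D mD D01) (igeM v D mD D01)) !indep.
  by rewrite (RintegralB measurableT (ige _) (ige _)) mulrBl.
have ED0 : 0 <= \int[P]_w D w by apply: Rintegral_ge0 => w _; case/andP: (D01 w).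
apply: (le_trans (ler_wpM2r ED0 (tail_ratio j))).
have c0 : 0 <= expR 3 * L * (1 + B).
  by rewrite mulr_ge0 ?mulr_ge0 ?expR_ge0//; [exact: ltW|move: B0; lra].
rewrite -[leLHS]mulrA ler_wpM2l// -indep; apply: le_Rintegral => //; [exact: igeM|exact: igeM|].
move=> w _; rewrite geE; have [Uv|Uv] := leP v (U j w); last by rewrite !mul0r.
by rewrite !mul1r winD_hi.
Qed.

(** The quantity [v - L - b i] is the left end of the interval seen from the
    mean [b i] of [N i + b i]; only its upper bound [B] matters since the
    normal hazard rate is increasing. *)
Lemma max_interval_le_tail :
  (P [set w | (v - L <= ord_maxr (fun i => N i w + b i) < v)%R] <=
  (expR 3 * L * (1 + B))%:E * P [set w | (v <= ord_maxr (fun i => (N i w + b i)%R))%R])%E.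
Proof.
have mA : measurable [set w | (v - L <= M w) && (M w < v)].
  have -> : [set w | (v - L <= M w) && (M w < v)] =
            [set w | v - L <= M w] `&` ~` [set w | v <= M w].
    apply/seteqP; split => w /=; first by move=> /andP[? ?]; split => //; apply/negP; rewrite -ltNge.
    by move=> [? /negP]; rewrite -ltNge => ?; apply/andP.
  by apply: measurableI => //; exact: measurableC.
rewrite -!Rintegral_boolr// -EFinM lee_fin.
have W01 j w : 0 <= win j w <= 1 by exact: prod01.
have iw v' j : P.-integrable setT (EFin \o (fun w => ge v' j w * win j w)).
  apply: int01; first exact: measurable_funM.
  move=> w; have /andP[? ?] := W01 j w.
  by rewrite mulr_ge0 ?ler0n//= mulr_ile1 ?ler0n// lern1 leq_b1.
have iwB j : P.-integrable setT (EFin \o (fun w => (ge (v - L) j w - ge v j w) * win j w)).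
  have -> : (fun w => (ge (v - L) j w - ge v j w) * win j w) =
            (fun w => ge (v - L) j w * win j w - ge v j w * win j w).
    by apply/funext => w; rewrite mulrBl.
  exact: (integrableB measurableT (iw _ _) (iw _ _)).
have sum_int (f : 'I_k.+1 -> T -> R) (r : seq 'I_k.+1) :
    (forall j, P.-integrable setT (EFin \o f j)) ->
    P.-integrable setT (EFin \o (fun w => \sum_(j <- r) f j w)) /\
    \int[P]_w \sum_(j <- r) f j w = \sum_(j <- r) \int[P]_w f j w.
  move=> fi; elim: r => [|j r [IHi IHe]].
    under eq_fun do rewrite big_nil; rewrite big_nil; split; last exact: Rintegral_prob_cst.
    by apply: int01 => // w; rewrite lexx ler01.
  under eq_fun do rewrite big_cons; rewrite big_cons -IHe; split.
    exact: (integrableD measurableT (fi j) IHi).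
  by rewrite RintegralD.
have [iS1 S1] := sum_int _ (index_enum 'I_k.+1) iwB.
have [iS2 S2] := sum_int _ (index_enum 'I_k.+1) (iw v).
(* at every point exactly one index wins, and it realizes the maximum *)
apply: (@le_trans _ _ (\int[P]_w \sum_j (ge (v - L) j w - ge v j w) * win j w)).
  apply: le_Rintegral => //.
    by apply: int01 => [|w]; [exact: measurable_boolr|rewrite ler0n lern1 leq_b1].
  move=> w _.
  have h0 j : 0 <= (ge (v - L) j w - ge v j w) * win j w.
    rewrite mulr_ge0//; last by case/andP: (W01 j w).
    by rewrite subr_ge0 !geE ler_nat; have [?|//] := leP v (U j w); have -> : v - L <= U j w by move: L0; lra.
  have [|_] := boolP (_ && _); last by apply: sumr_ge0.
  move=> /andP[Mlo Mhi].
  have [j wj Uj] := first_argmax_exists (fun i => U i w).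
  rewrite (bigD1 j)//= -[leLHS]addr0 lerD//; last exact: sumr_ge0.
  rewrite !geE -/(U j w) [win j w]wj mulr1 Uj -/(M w) Mlo [v <= M w]leNgt Mhi.
  by rewrite subr0.
rewrite S1.
apply: (@le_trans _ _ (\sum_j expR 3 * L * (1 + B) * \int[P]_w (ge v j w * win j w))).
  by apply: ler_sum => j _; exact: argmax_ratio.
rewrite -mulr_sumr ler_wpM2l//.
  by rewrite mulr_ge0 ?mulr_ge0 ?expR_ge0//; [exact: ltW|move: B0; lra].
rewrite -S2; apply: le_Rintegral => //.
  by apply: int01 => [|w]; [exact: measurable_boolr|rewrite ler0n lern1 leq_b1].
move=> w _; have [j wj Uj] := first_argmax_exists (fun i => U i w).
rewrite (bigD1 j)//= big1 ?addr0 => [|i ij].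
  by rewrite geE [win j w]wj mulr1 -/(U j w) Uj.
have [wi|wi] := first_argmax01 (fun i => U i w) i; first by rewrite [win i w]wi mulr0.
have := @first_argmax_unique _ _ (fun i => U i w) i j.
by rewrite wi wj oner_eq0 => /(_ isT isT) ji; rewrite ji eqxx in ij.
Qed.
End max_anticoncentration.

(** * Anti-concentration of one row *)

Section weighted_max.
Context d (T : measurableType d) (R : realType) (P : probability T R).
Context (k : nat) (N : 'I_k.+1 -> T -> R).
Hypothesis mN : forall i, measurable_fun setT (N i).
Hypothesis gN : forall c : 'I_k.+1 -> R, gaussian_rv P (fun w => \sum_i c i * N i w).
Hypothesis EN : forall i, \int[P]_w N i w = 0.
Hypothesis VN : forall i, \int[P]_w (N i w) ^+ 2 = 1.

Let M w := ord_maxr (fun i => N i w).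
Let a := \int[P]_w M w.

Lemma measurable_ord_maxr (f : 'I_k.+1 -> T -> R) :
  (forall i, measurable_fun setT (f i)) ->
  measurable_fun setT (fun w => ord_maxr (fun i => f i w)).
Proof.
move=> mf; rewrite /ord_maxr; elim: (index_enum _) => [|i r IH].
  by under eq_fun do rewrite big_nil; exact: mf.
by under eq_fun do rewrite big_cons; exact: measurable_maxr.
Qed.

Let mM : measurable_fun setT M.
Proof. exact: measurable_ord_maxr. Qed.

Let gNi i : gaussian_rv P (N i).
Proof. by have [c ->] := linear_span_mem N i; exact: gN. Qed.

Let sqr_int i : P.-integrable setT (EFin \o (fun w => N i w ^+ 2)).
Proof. by have [] := gaussian_stein (@mN i) (gNi i) (EN i). Qed.

Let dom_int i : P.-integrable setT (EFin \o (fun w => 2^-1 + 2^-1 * N i w ^+ 2)).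
Proof.
have e := integrableZl measurableT 2^-1 (sqr_int i).
have c : P.-integrable setT (EFin \o cst (2^-1 : R)).
  by apply: (bounded_probability_integrable _ (A := `|2^-1|)).
exact: (integrableD measurableT c e).
Qed.

Let dom_eq i : \int[P]_w (2^-1 + 2^-1 * N i w ^+ 2) = 1.
Proof.
have e := integrableZl measurableT 2^-1 (sqr_int i).
rewrite RintegralD//; last first.
  by apply: (bounded_probability_integrable _ (A := `|2^-1|)).
by rewrite RintegralZl// VN Rintegral_prob_cst; lra.
Qed.

Lemma integrable_ord_maxr : P.-integrable setT (EFin \o M).
Proof.
have h (r : seq 'I_k.+1) : P.-integrable setT
    (EFin \o (fun w => \sum_(i <- r) (2^-1 + 2^-1 * N i w ^+ 2))).
  elim: r => [|i r IH].
    under eq_fun do rewrite big_nil.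
    by apply: (bounded_probability_integrable _ (A := 0)) => // w; rewrite normr0.
  under eq_fun do rewrite big_cons.
  exact: (integrableD measurableT (dom_int i) IH).
apply: le_integrable (h (index_enum _)) => //; first exact/measurable_EFinP.
have d0 i w : 0 <= 2^-1 + 2^-1 * N i w ^+ 2 by rewrite (le_trans _ (norm_le_sqr _)).
move=> w _ /=; rewrite lee_fin [leRHS]ger0_norm ?sumr_ge0//.
rewrite /M; have [i ->] := ord_maxr_attained (fun i => N i w).
by rewrite (bigD1 i)//= (le_trans (norm_le_sqr _))// lerDl sumr_ge0.
Qed.

Lemma ord_maxr_mean_ge0 : 0 <= a.
Proof.
rewrite -(EN ord0); apply: le_Rintegral => //.
- by have [] := linear_span_centered mN gN EN (linear_span_mem N ord0).
- exact: integrable_ord_maxr.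
- by move=> w _; exact: (ord_maxr_ge (fun i => N i w)).
Qed.

(** Pointwise, [y * (y <= M)] is at most [M + (1 + N_0 ^+ 2) / 2], because the
    second term dominates the negative part of [M], and its mean is 1. *)
Lemma ord_maxr_markov y : 0 < y -> (P [set w | (y <= M w)%R] <= ((a + 1) / y)%:E)%E.
Proof.
move=> y0; have mA : measurable [set w | y <= M w].
  have -> : [set w | y <= M w] = M @^-1` `[y, +oo[%classic.
    by apply/seteqP; split => w /=; rewrite in_itv/= andbT.
  by rewrite -[X in measurable X]setTI; apply: mM.
have i1 : P.-integrable setT (EFin \o (fun w => (y <= M w)%R%:R : R)).
  apply: (bounded_probability_integrable _ (A := 1)); first exact: measurable_boolr.
  by move=> w; rewrite ger0_norm ?ler0n// lern1 leq_b1.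
rewrite -Rintegral_boolr// lee_fin ler_pdivlMr// mulrC -RintegralZl//.
rewrite -[X in a + X](dom_eq ord0) -RintegralD//; last exact: integrable_ord_maxr.
apply: le_Rintegral => //.
- exact: (integrableZl measurableT y i1).
- exact: (integrableD measurableT integrable_ord_maxr (dom_int ord0)).
move=> w _; have := norm_le_sqr (N ord0 w); have := ord_maxr_ge (fun i => N i w) ord0.
have : - N ord0 w <= `|N ord0 w| by rewrite -normrN ler_norm.
have : 0 <= `|N ord0 w| by [].
rewrite -/(M w); have [yM|_] := leP y (M w); rewrite ?mulr1 ?mulr0; lra.
Qed.

Variables (sig : 'I_k.+1 -> R) (slow shigh : R).
Hypothesis slow0 : 0 < slow.
Hypothesis sig_bounds : forall i, slow <= sig i <= shigh.

(** Dividing by [sig i], which is at least [slow], preserves signs; so the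
    maximum of [sig i * N i] is within [eps] of [x] only if the maximum of
    [U_i := N i - x / sig i] is between [- t] and [t], where [t := eps / slow]. *)
Lemma weighted_max_anticoncentration (x eps : R) : 0 < eps ->
  (P [set w | (`|ord_maxr (fun i => (sig i * N i w)%R) - x| <= eps)%R] <=
   (6 * expR 3 * (shigh / slow) * (eps / slow) * (a + 1))%:E)%E.
Proof.
move=> eps0; have [kap kapE] : exists kap, kap = shigh / slow by eexists.
have [t tE] : exists t, t = eps / slow by eexists.
rewrite -kapE -tE.
have sig0 i : 0 < sig i by have /andP[h _] := sig_bounds i; exact: lt_le_trans h.
have shigh0 : 0 < shigh by have /andP[_] := sig_bounds ord0; exact: lt_le_trans.
have kap1 : 1 <= kap.
  by rewrite kapE ler_pdivlMr// mul1r; have /andP[h] := sig_bounds ord0; exact: le_trans.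
have t0 : 0 < t by rewrite tE divr_gt0.
have e3 : 4 <= expR 3 :> R by have := expR_ge1Dx (3 : R); lra.
have a0 := ord_maxr_mean_ge0.
have kt0 : 0 < kap * t by rewrite mulr_gt0//; lra.
have kta : kap * t <= kap * t * (a + 1) by rewrite ler_peMr ?(ltW kt0)//; lra.
have kta0 : 0 <= kap * t * (a + 1) by rewrite (le_trans (ltW kt0)).
have big : 24 * (kap * t * (a + 1)) <= 6 * expR 3 * kap * t * (a + 1).
  have -> : 6 * expR 3 * kap * t * (a + 1) = 6 * expR 3 * (kap * t * (a + 1)) by ring.
  by rewrite ler_wpM2r//; lra.
pose b i : R := - (x / sig i).
pose U w := ord_maxr (fun i => N i w + b i).
have mU : measurable_fun setT U by apply: measurable_ord_maxr => i; exact: measurable_funD.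
have mU1 (v : R) : measurable [set w | v <= U w].
  have -> : [set w | v <= U w] = U @^-1` `[v, +oo[%classic.
    by apply/seteqP; split => w /=; rewrite in_itv/= andbT.
  by rewrite -[X in measurable X]setTI; apply: mU.
have mM1 (v : R) : measurable [set w | v <= M w].
  have -> : [set w | v <= M w] = M @^-1` `[v, +oo[%classic.
    by apply/seteqP; split => w /=; rewrite in_itv/= andbT.
  by rewrite -[X in measurable X]setTI; apply: mM.
have mU2 (v v' : R) : measurable [set w | v <= U w < v'].
  have -> : [set w | v <= U w < v'] = U @^-1` `[v, v'[%classic.
    by apply/seteqP; split => w /=; rewrite in_itv/=.
  by rewrite -[X in measurable X]setTI; apply: mU.
have mS : measurable [set w | `|ord_maxr (fun i => sig i * N i w) - x| <= eps].
  pose S w := ord_maxr (fun i => sig i * N i w).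
  have mSf : measurable_fun setT S by apply: measurable_ord_maxr => i; exact: measurable_funM.
  have -> : [set w | `|ord_maxr (fun i => sig i * N i w) - x| <= eps] = S @^-1` `[x - eps, x + eps]%classic.
    by apply/seteqP; split => w /=; rewrite in_itv/= -/(S w) ler_distl.
  by rewrite -[X in measurable X]setTI; apply: mSf.
have sub : [set w | `|ord_maxr (fun i => sig i * N i w) - x| <= eps] `<=` [set w | - t <= U w < 2 * t].
  move=> w /=; rewrite ler_distl => /andP[lo hi]; apply/andP; split.
    have [j Ej] := ord_maxr_attained (fun i => sig i * N i w).
    apply: le_trans (ord_maxr_ge (fun i => N i w + b i) j).
    have -> : N j w + b j = (sig j * N j w - x) / sig j by rewrite /b; field; rewrite gt_eqF.
    rewrite Ej in lo; rewrite ler_pdivlMr// mulNr.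
    have : eps <= t * sig j.
      by rewrite tE mulrAC ler_pdivlMr// ler_wpM2l ?(ltW eps0)//; case/andP: (sig_bounds j).
    lra.
  rewrite /U; have [j ->] := ord_maxr_attained (fun i => N i w + b i).
  have -> : N j w + b j = (sig j * N j w - x) / sig j by rewrite /b; field; rewrite gt_eqF.
  have hj := le_trans (ord_maxr_ge (fun i => sig i * N i w) j) hi.
  rewrite ltr_pdivrMr//.
  have : eps <= t * sig j.
    by rewrite tE mulrAC ler_pdivlMr// ler_wpM2l ?(ltW eps0)//; case/andP: (sig_bounds j).
  move: eps0 hj => /=; lra.
(* when [t] is not small the bound exceeds 1 *)
have [triv|/ltW small] := leP 1 (12 * (kap * t)).
  apply: (le_trans (probability_le1 P mS)); rewrite lee_fin.
  by apply: le_trans big; lra.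
have t1 : 12 * t <= 1.
  by have : t <= kap * t; [rewrite ler_peMl// ltW|lra].
have [B BE] : exists B, B = Num.max x 0 / slow by eexists.
have B0 : 0 <= B by rewrite BE divr_ge0 ?le_max ?lexx ?orbT// ltW.
have xB i : 0 < x -> B / kap <= x / sig i.
  move=> x0; have -> : B / kap = x / shigh.
    by rewrite BE kapE; case: (leP x 0) => ?; [lra|field; rewrite !gt_eqF].
  rewrite ler_wpM2l ?(ltW x0)// lef_pV2 ?posrE//.
  by case/andP: (sig_bounds i).
have kapV : 0 < kap^-1 by rewrite invr_gt0; lra.
(* [max_interval_le_tail] is applied to [- t <= U w < 2 * t], so that
   [L = 3 * t] and [v = 2 * t] *)
have [LB|LB] := leP (3 * t * (1 + B)) 1.
  have bB i : 2 * t - 3 * t - b i <= B.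
    have -> : 2 * t - 3 * t - b i = x / sig i - t by rewrite /b; ring.
    apply: (@le_trans _ _ (x / sig i)); first by lra.
    rewrite BE; case: (leP x 0) => x0.
      by rewrite mul0r -oppr_ge0 -mulNr divr_ge0 ?oppr_ge0// ltW.
    by rewrite ler_wpM2l ?(ltW x0)// lef_pV2 ?posrE//; case/andP: (sig_bounds i).
  have L0 : 0 < 3 * t by lra.
  have := max_interval_le_tail mN gN EN VN L0 B0 LB bB.
  have -> : 2 * t - 3 * t = - t by ring.
  rewrite -/U => h.
  apply: (le_trans (le_measure P _ _ sub)); rewrite ?inE//.
  apply: (le_trans h).
  (* if [B <= kap] this bound exceeds 1; otherwise [x] is positive and
     [2 * t <= U w] forces some [N j w] to be at least [B / kap] *)
  have tail : (P [set w | (2 * t <= U w)%R] <= (2 * kap * (a + 1) / (1 + B))%:E)%E.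
    have [B1|B1] := leP B kap.
      apply: (le_trans (probability_le1 P (mU1 _))); rewrite lee_fin ler_pdivlMr ?mul1r; last by lra.
      by nra.
    have x0 : 0 < x.
      by rewrite ltNge; apply/negP => x0; move: B1; rewrite BE; case: (leP x 0) => ?; rewrite ?mul0r; lra.
    have Bk0 : 0 < B / kap by rewrite mulr_gt0//; lra.
    apply: (@le_trans _ _ (P [set w | (B / kap <= M w)%R])).
      apply: le_measure; rewrite ?inE// => w /=.
      rewrite /U; have [j ->] := ord_maxr_attained (fun i => N i w + b i).
      move=> h1; apply: le_trans (ord_maxr_ge (fun i => N i w) j).
      by have := xB j x0; move: h1; rewrite /b; lra.
    apply: (le_trans (ord_maxr_markov Bk0)); rewrite lee_fin.
    rewrite ler_pdivlMr; last by lra.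
    have -> : (a + 1) / (B / kap) * (1 + B) = (a + 1) * kap * ((1 + B) / B).
      by field; rewrite !gt_eqF//; lra.
    have -> : 2 * kap * (a + 1) = (a + 1) * kap * 2 by ring.
    rewrite ler_wpM2l//; first by rewrite mulr_ge0//; lra.
    by rewrite ler_pdivrMr; lra.
  have c0 : 0 <= expR 3 * (3 * t) * (1 + B).
    by rewrite !mulr_ge0 ?expR_ge0 // ?addr_ge0 // ltW.
  apply: (le_trans (lee_wpmul2l _ tail)); first by rewrite lee_fin.
  rewrite -EFinM lee_fin le_eqVlt; apply/orP; left; apply/eqP.
  by field; rewrite gt_eqF//; lra.
(* now [x] is so large that Markov's inequality alone concludes *)
have B4 : 1 < 4 * t * B by nra.
have Bpos : 0 < B by rewrite ltNge; apply/negP => B1; nra.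
have x0 : 0 < x.
  by rewrite ltNge; apply/negP => x0; move: Bpos; rewrite BE; case: (leP x 0) => ?; rewrite ?mul0r; lra.
have Bk0 : 0 < B / (2 * kap) by rewrite divr_gt0//; lra.
have tB : t <= B / (2 * kap).
  rewrite ler_pdivlMr; last by lra.
  by nra.
apply: (@le_trans _ _ (P [set w | (B / (2 * kap) <= M w)%R])).
  apply: le_measure; rewrite ?inE// => w /sub /= /andP[+ _].
  rewrite /U; have [j ->] := ord_maxr_attained (fun i => N i w + b i).
  move=> h1; apply: le_trans (ord_maxr_ge (fun i => N i w) j).
  have : B / kap = B / (2 * kap) + B / (2 * kap) by field; rewrite gt_eqF//; lra.
  by have := xB j x0; move: h1; rewrite /b; lra.
apply: (le_trans (ord_maxr_markov Bk0)); rewrite lee_fin; apply: le_trans big.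
have -> : (a + 1) / (B / (2 * kap)) = 2 * (kap * (a + 1)) / B.
  by field; rewrite !gt_eqF//; lra.
rewrite ler_pdivrMr//.
have -> : 24 * (kap * t * (a + 1)) * B = 6 * (kap * (a + 1)) * (4 * t * B) by ring.
have : 0 <= kap * (a + 1) by rewrite mulr_ge0//; lra.
by nra.
Qed.

End weighted_max.

(** * The min-max of a Gaussian matrix *)

Lemma measurable_ord_minr d (T : measurableType d) (R : realType) k
    (f : 'I_k.+1 -> T -> R) : (forall i, measurable_fun setT (f i)) ->
  measurable_fun setT (fun w => ord_minr (fun i => f i w)).
Proof.
move=> mf; rewrite /ord_minr; elim: (index_enum _) => [|i r IH].
  by under eq_fun do rewrite big_nil; exact: mf.
by under eq_fun do rewrite big_cons; exact: measurable_minr.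
Qed.

Section standardized_row.
Context d (T : measurableType d) (R : realType) (P : probability T R).
Context (n m : nat) (X : 'I_n.+1 -> 'I_m.+1 -> {RV P >-> R}).
Hypotheses (gX : gaussian_mx X) (cX : centered_mx X).

Lemma gaussian_row i (c : 'I_m.+1 -> R) :
  gaussian_rv P (fun w => \sum_j c j * X i j w).
Proof.
have := gX (\matrix_(i', j) (if i' == i then c j else 0)).
congr gaussian_rv; apply/funext => w.
rewrite (bigD1 i)//= [X in _ + X]big1 ?addr0 => [|i' i'i].
  by apply: eq_bigr => j _; rewrite mxE eqxx.
by apply: big1 => j _; rewrite mxE (negbTE i'i) mul0r.
Qed.

Lemma gaussian_entry i j : gaussian_rv P (X i j).
Proof.
by have [c ->] := linear_span_mem (fun j => X i j : T -> R) j; exact: gaussian_row.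
Qed.

Lemma Rintegral_entry i j : \int[P]_w X i j w = 0.
Proof. by rewrite /Rintegral -expectation_def cX. Qed.

Lemma Rintegral_entry_sqr i j :
  P.-integrable setT (EFin \o (fun w => X i j w ^+ 2)) /\
  \int[P]_w X i j w ^+ 2 = stddev X i j ^+ 2.
Proof.
have [i2 _ _] := gaussian_stein (measurable_funP (X i j)) (gaussian_entry i j) (Rintegral_entry i j).
split=> //; rewrite /stddev sqr_sqrtr; last by rewrite fine_ge0// variance_ge0.
rewrite /variance covariance.unlock cX /= unlock.
congr fine; apply: eq_integral => w _.
by rewrite -[RHS]/(((X i j w - 0) * (X i j w - 0))%:E) subr0 expr2.
Qed.

End standardized_row.

Theorem lemma9 (R : realType) (slow shigh : R) (slow_gt0 : 0 < slow) :
  exists2 C : R, 0 < C &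
    forall (n m : nat) (d : measure_display) (T : measurableType d)
      (P : probability T R) (X : 'I_n.+1 -> 'I_m.+1 -> {RV P >-> R}),
      gaussian_mx X -> centered_mx X ->
      sigma_min X = slow -> sigma_max X = shigh ->
      minmax_unique X ->
      forall eps : R, 0 < eps ->
        (anticoncentration P (fun w => minmax (sample_mx X w)) eps <=
         (C * eps)%:E *
         (\sum_(i < n.+1) mean_std_max X i +
          (n.+1%:R * Num.max 1 (Num.sqrt (ln (slow / eps))))%:E))%E.
Proof.
(* [shigh] is only known to be at least [slow] once a matrix is given *)
pose C := 6 * expR 3 * (Num.max slow shigh / slow) / slow.
have C0 : 0 < C.
  by rewrite !divr_gt0// !mulr_gt0 ?expR_gt0// ?invr_gt0// lt_max slow_gt0.
exists C => // n m d T P X gX cX smin smax _ eps eps0.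
have sl i j : slow <= stddev X i j.
  rewrite -smin; apply: le_trans (ord_minr_le _ j).
  exact: (ord_minr_le (fun i => ord_minr (stddev X i)) i).
have sh i j : stddev X i j <= shigh.
  rewrite -smax; apply: le_trans (ord_maxr_ge _ j) _.
  exact: (ord_maxr_ge (fun i => ord_maxr (stddev X i)) i).
have s0 i j : 0 < stddev X i j by apply: lt_le_trans (sl i j).
have maxE : Num.max slow shigh = shigh.
  by apply/max_idPr; apply: le_trans (sl ord0 ord0) (sh ord0 ord0).
pose N i j w := X i j w / stddev X i j.
have mN i j : measurable_fun setT (N i j) by exact: measurable_funM.
have gN i (c : 'I_m.+1 -> R) : gaussian_rv P (fun w => \sum_j c j * N i j w).
  have := gaussian_row gX i (fun j => c j / stddev X i j).
  congr gaussian_rv; apply/funext => w; apply: eq_bigr => j _.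
  by rewrite /N; ring.
have EN i j : \int[P]_w N i j w = 0.
  have [i1 _] := linear_span_centered (N := fun j => X i j : T -> R)
    (fun j => measurable_funP (X i j)) (gaussian_row gX i) (Rintegral_entry cX i)
    (linear_span_mem (fun j => X i j : T -> R) j).
  by rewrite RintegralZr// Rintegral_entry// mul0r.
have VN i j : \int[P]_w N i j w ^+ 2 = 1.
  have [i2 V] := Rintegral_entry_sqr gX cX i j.
  under eq_Rintegral do rewrite /N exprMn.
  by rewrite RintegralZr// V -exprMn mulfV ?expr1n// gt_eqF.
pose a i := \int[P]_w ord_maxr (fun j => N i j w).
have meanE i : mean_std_max X i = (a i)%:E.
  rewrite /mean_std_max unlock /a /Rintegral fineK//.
  by apply: integrable_fin_num => //; exact: (integrable_ord_maxr (@mN i) (gN i) (EN i)).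
have row i x : (P [set w | (`|ord_maxr (fun j => X i j w) - x| <= eps)%R] <=
    (C * eps * (a i + 1))%:E)%E.
  have sb j : slow <= stddev X i j <= shigh by rewrite sl sh.
  have := weighted_max_anticoncentration (@mN i) (gN i) (EN i) (VN i) slow_gt0 sb x eps0.
  have -> : 6 * expR 3 * (shigh / slow) * (eps / slow) = C * eps.
    by rewrite /C maxE; ring.
  have NE w : (fun j => stddev X i j * N i j w) = (fun j => X i j w).
    by apply/funext => j; rewrite /N mulrC divfK// gt_eqF.
  by under eq_set do rewrite NE; exact.
have mrow i : measurable_fun setT (fun w => ord_maxr (fun j => X i j w)).
  by apply: measurable_ord_maxr => j; exact: measurable_funP.
have mminmax : measurable_fun setT (fun w => minmax (sample_mx X w)).
  rewrite /minmax; apply: measurable_ord_minr => i.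
  have -> : (fun w => ord_maxr (sample_mx X w i)) = (fun w => ord_maxr (fun j => X i j w)).
    by apply/funext => w; congr ord_maxr; apply/funext => j; rewrite mxE.
  exact: mrow.
pose near_row x i := [set w | `|ord_maxr (fun j => X i j w) - x| <= eps].
have mnear x i : measurable (near_row x i).
  have -> : near_row x i =
      (fun w => ord_maxr (fun j => X i j w)) @^-1` `[x - eps, x + eps]%classic.
    by apply/seteqP; split => w /=; rewrite in_itv/= -ler_distl.
  by rewrite -[X in measurable X]setTI; exact: mrow.
apply: ge_ereal_sup => _ [x _ <-].
have sub : [set w | `|minmax (sample_mx X w) - x| <= eps] `<=`
    \big[setU/set0]_(i < n.+1) near_row x (inord i).
  move=> w /=; rewrite /minmax.
  have [i ->] := ord_minr_attained (fun i => ord_maxr (fun j => sample_mx X w i j)).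
  have -> : (fun j => sample_mx X w i j) = (fun j => X i j w).
    by apply/funext => j; rewrite mxE.
  rewrite -(bigcup_mkord _ (fun i => near_row x (inord i))) => h.
  by exists i; rewrite ?inord_val/=.
have mS : measurable [set w | `|minmax (sample_mx X w) - x| <= eps].
  have -> : [set w | `|minmax (sample_mx X w) - x| <= eps] =
      (fun w => minmax (sample_mx X w)) @^-1` `[x - eps, x + eps]%classic.
    by apply/seteqP; split => w /=; rewrite in_itv/= -ler_distl.
  by rewrite -[X in measurable X]setTI; exact: mminmax.
have := @content_subadditive _ _ _ P _ (fun k => near_row x (inord k)) n.+1
  (fun k _ => mnear x _) mS sub.
move=> /le_trans; apply.
apply: (@le_trans _ _ (\sum_(i < n.+1) (C * eps * (a i + 1))%:E)%E).
  by apply: lee_sum => i _; rewrite inord_val; exact: row.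
under [X in (_ <= _ * (X + _))%E]eq_bigr do rewrite meanE.
rewrite !sumEFin -EFinD -EFinM lee_fin -mulr_sumr ler_wpM2l//.
  by rewrite mulr_ge0// ltW.
rewrite big_split/= lerD2l sumr_const card_ord.
by rewrite ler_peMr// le_max lexx.
Qed.
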